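(* Let $X$ be an algebraic variety over $k$, let $\varphi\colon \mathbb{G}_{\mathrm{m}}\times X\dashrightarrow X$ be a faithful rational $\mathbb{G}_{\mathrm{m}}$-action, let $\partial=D_\varphi\colon K_X\to K_X$ be the corresponding rational semisimple derivation, and let $s\in K_X$ be a nonzero rational slice for $\varphi$. Then $s$ is transcendental over $K_X^{\mathbb{G}_{\mathrm{m}}}$, $$K_X=K_X^{\mathbb{G}_{\mathrm{m}}}(s)=(\ker\partial)(s),$$ and $\partial=s\frac{d}{ds}$ on $K_X^{\mathbb{G}_{\mathrm{m}}}(s)$.
   Context: Let $k$ be an algebraically closed field of characteristic zero. A variety is an integral separated scheme of finite type over $k$; $K_X$ is the field of rational functions of $X$. $\mathbb{G}_{\mathrm{m}}$ is the multiplicative group over $k$, with coordinate $t$, group law $\mu$ and neutral element $e\colon \operatorname{Spec}(k)\to\mathbb{G}_{\mathrm{m}}$. A rational $\mathbb{G}_{\mathrm{m}}$-action on $X$ is a rational map $\varphi\colon \mathbb{G}_{\mathrm{m}}\times X\dashrightarrow X$ such that, as rational maps, $\varphi\circ(\mathrm{id}_{\mathbb{G}_{\mathrm{m}}}\times\varphi)=\varphi\circ(\mu\times \mathrm{id}_X)$ and $\varphi\circ(e\times \mathrm{id}_X)=\mathrm{pr}_2$. Its comorphism $\varphi^*\colon K_X\to k(\mathbb{G}_{\mathrm{m}}\times X)=K_X(t)$ has image in $\{r\in K_X(t)\mid\operatorname{ord}_1(r)\ge0\}$, where $\operatorname{ord}_1$ is the order of vanishing at $t=1$. Every $g\in\mathbb{G}_{\mathrm{m}}$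 gives a birational automorphism $\varphi_g\colon X\dashrightarrow X$, $x\mapsto\varphi(g,x)$, and $g\mapsto\varphi_g$ is a group homomorphism $\mathbb{G}_{\mathrm{m}}\to\operatorname{Bir}(X)$; the action is faithful if this homomorphism is injective. The field of invariants is $K_X^{\mathbb{G}_{\mathrm{m}}}=\{f\in K_X\mid\varphi^*(f)=f\}$. A rational slice is an element $s\in K_X$ with $\varphi^*(s)=ts$. The derivation associated with $\varphi$ is $D_\varphi\colon K_X\to K_X$, $f\mapsto\operatorname{ev}_1\circ\frac{d}{dt}\circ\varphi^*(f)$, with $\operatorname{ev}_1$ evaluation at $t=1$; it is a rational semisimple $k$-derivation, i.e. $K_X$ is generated as a field by elements $a_i$ with $D_\varphi(a_i)=\lambda_ia_i$, $\lambda_i\in\mathbb{Z}$. The derivation $s\frac{d}{ds}$ is the $K_X^{\mathbb{G}_{\mathrm{m}}}$-derivation sending $s$ to $s$. *)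

(* Defs.v *)
(* Varieties over an algebraically closed field k are taken in the classical
   sense (Serre, Springer, Kempf): spaces of closed points carrying a Zariski
   topology and a sheaf of k-valued functions.  Those that are irreducible,
   separated and covered by finitely many affine open sets
   form a category equivalent to that of integral separated schemes of finite
   type over k, a scheme corresponding to its set of closed points. *)
From HB Require Import structures.
From mathcomp Require Import all_boot all_order all_algebra.
From mathcomp Require Import generic_quotient fraction.
From mathcomp Require Import boolp classical_sets topology_structure.
From mathcomp Require Import(canonicals) mpoly.

Set Implicit Arguments.
Unset Strict Implicit.
Unset Printing Implicit Defensive.

Import GRing.Theory.
Local Open Scope classical_set_scope.
Local Open Scope ring_scope.

(* [regular U f] only depends on the restriction of f to U, and is meaningful
   for open U only; [f] is total because functions outside U are ignored. *)
Record funSpace (k : fieldType) := FunSpace {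
  carrier :> topologicalType;
  regular : set carrier -> set (carrier -> k);
  regular_local : forall (U : set carrier) (f : carrier -> k),
    (forall x, U x -> exists V g, [/\ open V, V x, regular V g &
       forall y, U y -> V y -> f y = g y]) -> regular U f;
  regular_sub : forall (U V : set carrier) (f : carrier -> k),
    open U -> open V -> V `<=` U -> regular U f -> regular V f;
  regular_cst : forall (U : set carrier) (c : k),
    open U -> regular U (fun=> c);
  regular_add : forall (U : set carrier) (f g : carrier -> k), open U ->
    regular U f -> regular U g -> regular U (fun x => f x + g x);
  regular_mul : forall (U : set carrier) (f g : carrier -> k), open U ->
    regular U f -> regular U g -> regular U (fun x => f x * g x);
  regular_inv : forall (U : set carrier) (f : carrier -> k), open U ->
    regular U f -> open (U `&` [set x | f x != 0]) /\
    regular (U `&` [set x | f x != 0]) (fun x => (f x)^-1)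
}.

Definition morphism_on (k : fieldType) (X Y : funSpace k) (U : set X)
    (f : X -> Y) : Prop :=
  forall (V : set Y) (h : Y -> k), open V -> regular V h ->
    open (U `&` f @^-1` V) /\ regular (U `&` f @^-1` V) (h \o f).

Definition generically (k : fieldType) (X : funSpace k) (P : set X) : Prop :=
  exists W : set X, [/\ open W, W !=set0 & W `<=` P].

(* The space with functions whose open sets are the unions of the sets
   D `&` {f != 0}, and whose regular functions are locally quotients f / g,
   for f and g in a given family of functions: [B D f] reads "f is a function
   of the family, considered on the domain D". *)
Section Zariski.
Variables (k : fieldType) (T : choiceType) (B : set T -> set (T -> k)).

Record fun_basis : Prop := FunBasis {
  fun_basis_cover : forall x, exists D, D x /\ B D (fun=> 1);
  fun_basis_cst : forall D f c, B D f -> B D (fun=> c);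
  fun_basis_add : forall D f g, B D f -> B D g -> B D (fun x => f x + g x);
  fun_basis_mul : forall D f g, B D f -> B D g -> B D (fun x => f x * g x);
  fun_basis_res : forall D E f g, B D f -> B E g -> B (D `&` E) f
}.

Definition zariski_open (V : set T) : Prop :=
  forall x, V x -> exists D f,
    [/\ B D f, D x, f x != 0 & forall y, D y -> f y != 0 -> V y].

Definition zariski_regular (V : set T) (h : T -> k) : Prop :=
  forall x, V x -> exists D f g,
    [/\ B D f, B D g, D x, g x != 0 &
        forall y, V y -> D y -> g y != 0 -> h y = f y / g y].

Hypothesis Bax : fun_basis.

Lemma fun_basis_resr D E f g : B D f -> B E g -> B (D `&` E) g.
Proof. by move=> Df Eg; rewrite setIC; apply: fun_basis_res Eg Df. Qed.

Lemma zariski_openT : zariski_open setT.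
Proof.
move=> x _; have [D [Dx D1]] := fun_basis_cover Bax x.
by exists D, (fun=> 1); split=> //; rewrite oner_neq0.
Qed.

Lemma zariski_openI (U V : set T) :
  zariski_open U -> zariski_open V -> zariski_open (U `&` V).
Proof.
move=> oU oV x [Ux Vx].
have [D [f [Df Dx fx hf]]] := oU x Ux; have [E [g [Eg Ex gx hg]]] := oV x Vx.
exists (D `&` E), (fun y => f y * g y); split => //.
- apply: fun_basis_mul => //; first exact: fun_basis_res Df Eg.
  exact: fun_basis_resr Df Eg.
- by rewrite mulf_neq0.
- move=> y [Dy Ey]; rewrite mulf_eq0 negb_or => /andP[fy gy].
  by split; [apply: hf | apply: hg].
Qed.

Lemma zariski_open_bigU (I : Type) (f : I -> set T) :
  (forall i, zariski_open (f i)) -> zariski_open (\bigcup_i f i).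
Proof.
move=> of_ x [i _ fix_]; have [D [g [Dg Dx gx h]]] := of_ i x fix_.
by exists D, g; split => // y Dy gy; exists i => //; apply: h.
Qed.

Definition zariski_type of fun_basis : Type := T.
HB.instance Definition _ := Choice.on (zariski_type Bax).
HB.instance Definition _ := isOpenTopological.Build (zariski_type Bax)
  zariski_openT zariski_openI zariski_open_bigU.

Lemma zariski_openE (U : set (zariski_type Bax)) : open U = zariski_open U.
Proof. by []. Qed.

Lemma zariski_local (U : set T) (h : T -> k) :
  (forall x, U x -> exists V g, [/\ zariski_open V, V x, zariski_regular V g &
    forall y, U y -> V y -> h y = g y]) -> zariski_regular U h.
Proof.
move=> H x Ux; have [V [g [oV Vx gV hg]]] := H x Ux.
have [D [a [b [Da Db Dx bx ab]]]] := gV x Vx.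
have [E [f [Ef Ex fx hf]]] := oV x Vx.
have DEf := fun_basis_resr Da Ef.
exists (D `&` E), (fun y => a y * f y), (fun y => b y * f y); split => //.
- by apply: fun_basis_mul => //; apply: fun_basis_res Da Ef.
- by apply: fun_basis_mul => //; apply: fun_basis_res Db Ef.
- by rewrite mulf_neq0.
- move=> y Uy [Dy Ey]; rewrite mulf_eq0 negb_or => /andP[by_ fy].
  have Vy : V y by apply: hf.
  by rewrite hg // ab // -mulf_div divff // mulr1.
Qed.

Lemma zariski_sub (U V : set T) (h : T -> k) : V `<=` U ->
  zariski_regular U h -> zariski_regular V h.
Proof.
move=> VU hU x Vx; have [D [f [g [Df Dg Dx gx fg]]]] := hU x (VU x Vx).
by exists D, f, g; split => // y Vy; apply: fg; apply: VU.
Qed.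

Lemma zariski_cst (U : set T) (c : k) : zariski_regular U (fun=> c).
Proof.
move=> x _; have [D [Dx D1]] := fun_basis_cover Bax x.
exists D, (fun=> c), (fun=> 1); split => //; last by move=> *; rewrite divr1.
  exact: fun_basis_cst D1.
exact: oner_neq0.
Qed.

Lemma zariski_add (U : set T) (g h : T -> k) :
  zariski_regular U g -> zariski_regular U h ->
  zariski_regular U (fun x => g x + h x).
Proof.
move=> gU hU x Ux.
have [D [a [b [Da Db Dx bx ab]]]] := gU x Ux.
have [E [c [d [Ec Ed Ex dx cd]]]] := hU x Ux.
have [Ra Rb] := (fun_basis_res Bax Da Ec, fun_basis_res Bax Db Ec).
have [Rc Rd] := (fun_basis_resr Da Ec, fun_basis_resr Da Ed).
exists (D `&` E), (fun y => a y * d y + c y * b y), (fun y => b y * d y).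
split => //; first by apply: fun_basis_add => //; apply: fun_basis_mul.
- exact: fun_basis_mul.
- by rewrite mulf_neq0.
- move=> y Uy [Dy Ey]; rewrite mulf_eq0 negb_or => /andP[by_ dy].
  by rewrite ab // cd // addf_div.
Qed.

Lemma zariski_mul (U : set T) (g h : T -> k) :
  zariski_regular U g -> zariski_regular U h ->
  zariski_regular U (fun x => g x * h x).
Proof.
move=> gU hU x Ux.
have [D [a [b [Da Db Dx bx ab]]]] := gU x Ux.
have [E [c [d [Ec Ed Ex dx cd]]]] := hU x Ux.
have [Ra Rb] := (fun_basis_res Bax Da Ec, fun_basis_res Bax Db Ec).
have [Rc Rd] := (fun_basis_resr Da Ec, fun_basis_resr Da Ed).
exists (D `&` E), (fun y => a y * c y), (fun y => b y * d y).
split => //; [exact: fun_basis_mul | exact: fun_basis_mul | | ].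
- by rewrite mulf_neq0.
- move=> y Uy [Dy Ey]; rewrite mulf_eq0 negb_or => /andP[by_ dy].
  by rewrite ab // cd // mulf_div.
Qed.

Lemma zariski_inv (U : set T) (h : T -> k) : zariski_open U ->
  zariski_regular U h -> zariski_open (U `&` [set x | h x != 0]) /\
  zariski_regular (U `&` [set x | h x != 0]) (fun x => (h x)^-1).
Proof.
move=> oU hU; split=> x [Ux /= hx];
  have [D [a [b [Da Db Dx bx ab]]]] := hU x Ux.
- have ax : a x != 0 by apply: contraNneq hx => a0; rewrite ab // a0 mul0r.
  have [E [f [Ef Ex fx hf]]] := oU x Ux.
  have Rf := fun_basis_resr Da Ef.
  have [Ra Rb] := (fun_basis_res Bax Da Ef, fun_basis_res Bax Db Ef).
  exists (D `&` E), (fun y => f y * (a y * b y)); split => //.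
  + by apply: fun_basis_mul => //; apply: fun_basis_mul.
  + by rewrite !mulf_neq0.
  + move=> y [Dy Ey]; rewrite !mulf_eq0 !negb_or => /and3P[fy ay by_].
    have Uy : U y by apply: hf.
    by split => //=; rewrite ab // mulf_neq0 ?invr_neq0.
- have ax : a x != 0 by apply: contraNneq hx => a0; rewrite ab // a0 mul0r.
  exists D, (fun y => b y * b y), (fun y => a y * b y); split => //.
  + exact: fun_basis_mul.
  + exact: fun_basis_mul.
  + by rewrite mulf_neq0.
  + move=> y [Uy _] Dy; rewrite mulf_eq0 negb_or => /andP[ay by_].
    by rewrite ab // invf_div -mulf_div divff // mulr1.
Qed.

Definition zariski_space : funSpace k := @FunSpace k (zariski_type Bax)
  zariski_regular
  zariski_local
  (fun U V f _ _ => @zariski_sub U V f)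
  (fun U c _ => @zariski_cst U c)
  (fun U f g _ => @zariski_add U f g)
  (fun U f g _ => @zariski_mul U f g)
  zariski_inv.
End Zariski.

Section ZeroLocus.
Variables (k : fieldType) (n : nat) (I : set (mpoly.mpoly n k)).

Definition point_of_An (v : 'rV[k]_n) : 'I_n -> k := fun i => v ord0 i.

Definition zero_locus : Type :=
  {v : 'rV[k]_n | `[< forall f, I f -> mpoly.meval (point_of_An v) f = 0 >]}.
HB.instance Definition _ := Choice.on zero_locus.

Definition zero_locus_basis (D : set zero_locus) (h : zero_locus -> k) : Prop :=
  D = setT /\
  exists f : mpoly.mpoly n k, h = fun v => mpoly.meval (point_of_An (val v)) f.

Lemma zero_locus_basis_ax : fun_basis zero_locus_basis.
Proof.
split.
- move=> x; exists setT; split=> //; split=> //; exists 1.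
  by apply/funext => v; rewrite mpoly.meval1.
- move=> D _ c [-> _]; split=> //; exists (mpoly.mpolyC n c).
  by apply/funext => v; rewrite mpoly.mevalC.
- move=> D _ _ [-> [f ->]] [_ [g ->]]; split=> //; exists (f + g).
  by apply/funext => v; rewrite mpoly.mevalD.
- move=> D _ _ [-> [f ->]] [_ [g ->]]; split=> //; exists (f * g).
  by apply/funext => v; rewrite mpoly.mevalM.
- by move=> D E _ _ [-> [f ->]] [-> _]; split; [rewrite setTI | exists f].
Qed.

Definition zero_locus_space : funSpace k := zariski_space zero_locus_basis_ax.
End ZeroLocus.

(* The open subset U of X is isomorphic to a closed subset of affine space. *)
Definition affine_open (k : fieldType) (X : funSpace k) (U : set X) : Prop :=
  open U /\
  exists (n : nat) (I : set (mpoly.mpoly n k))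
         (f : X -> zero_locus_space I) (g : zero_locus_space I -> X),
    [/\ morphism_on U f, morphism_on setT g, forall v, U (g v),
        forall v, f (g v) = v & forall x, U x -> g (f x) = x].

Section Product.
Variables (k : fieldType) (X Y : funSpace k).

(* The image of k[U] (x) k[V] in the functions on U `*` V. *)
Inductive tensor_fun (U : set X) (V : set Y) : set (X * Y -> k) :=
| tensor_fst f of regular U f : tensor_fun U V (fun p => f p.1)
| tensor_snd g of regular V g : tensor_fun U V (fun p => g p.2)
| tensor_add f g of tensor_fun U V f & tensor_fun U V g :
    tensor_fun U V (fun p => f p + g p)
| tensor_mul f g of tensor_fun U V f & tensor_fun U V g :
    tensor_fun U V (fun p => f p * g p).

Definition prod_basis (D : set (X * Y)) (h : X * Y -> k) : Prop :=
  exists U V, [/\ open U, open V, D = U `*` V & tensor_fun U V h].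

Lemma tensor_fun_sub (U U' : set X) (V V' : set Y) h :
  open U -> open U' -> open V -> open V' -> U' `<=` U -> V' `<=` V ->
  tensor_fun U V h -> tensor_fun U' V' h.
Proof.
move=> oU oU' oV oV' sU sV; elim=> [f fr|g gr|f g _ Hf _ Hg|f g _ Hf _ Hg].
- by apply: tensor_fst; apply: regular_sub fr.
- by apply: tensor_snd; apply: regular_sub gr.
- exact: tensor_add.
- exact: tensor_mul.
Qed.

Lemma prod_basis_res D E f g :
  prod_basis D f -> prod_basis E g -> prod_basis (D `&` E) f.
Proof.
move=> [U [V [oU oV -> tf]]] [U' [V' [oU' oV' -> tg]]].
exists (U `&` U'), (V `&` V'); split; [exact: openI|exact: openI| |].
  by rewrite setXI.
apply: tensor_fun_sub tf => //; try exact: openI; exact: subIsetl.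
Qed.

Lemma prod_basis_op (op : k -> k -> k) :
  (forall U V f g, tensor_fun U V f -> tensor_fun U V g ->
     tensor_fun U V (fun p => op (f p) (g p))) ->
  forall D f g, prod_basis D f -> prod_basis D g ->
  prod_basis D (fun p => op (f p) (g p)).
Proof.
move=> Hop D f g [U [V [oU oV eD tf]]] [U' [V' [oU' oV' eD' tg]]].
exists (U `&` U'), (V `&` V'); split; [exact: openI|exact: openI| |].
  by rewrite setXI -eD -eD' setIid.
have [oUU oVV] := (openI oU oU', openI oV oV').
apply: Hop; [apply: tensor_fun_sub tf | apply: tensor_fun_sub tg] => //;
  by [exact: subIsetl | exact: subIsetr].
Qed.

Lemma prod_basis_ax : fun_basis prod_basis.
Proof.
split.
- move=> x; exists setT; split=> //; exists setT, setT.
  split; [exact: openT|exact: openT|by rewrite setXTT|].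
  by apply: (@tensor_fst _ _ (fun=> 1)); apply/regular_cst/openT.
- move=> D _ c [U [V [oU oV -> _]]]; exists U, V; split => //.
  by apply: (@tensor_fst _ _ (fun=> c)); apply: regular_cst.
- by apply: (prod_basis_op (op := +%R)) => *; apply: tensor_add.
- by apply: (prod_basis_op (op := *%R)) => *; apply: tensor_mul.
- exact: prod_basis_res.
Qed.

(* Its topology is finer than the product topology. *)
Definition prod_space : funSpace k := zariski_space prod_basis_ax.
End Product.

Record irrSpace (k : fieldType) := IrrSpace {
  irr_space :> funSpace k;
  irr_nonempty : exists x : irr_space, True;
  irr_open : forall U V : set irr_space,
    open U -> open V -> U !=set0 -> V !=set0 -> U `&` V !=set0
}.

Section ProductIrr.
Variable k : fieldType.

Lemma tensor_fun_fstr (X Y : funSpace k) (U : set X) (V : set Y) h y :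
  open U -> V y -> tensor_fun U V h -> regular U (fun x => h (x, y)).
Proof.
move=> oU Vy; elim=> [f fr|g gr|f g _ Hf _ Hg|f g _ Hf _ Hg] //=.
- exact: regular_cst.
- exact: regular_add.
- exact: regular_mul.
Qed.

Lemma tensor_fun_sndr (X Y : funSpace k) (U : set X) (V : set Y) h x :
  open V -> U x -> tensor_fun U V h -> regular V (fun y => h (x, y)).
Proof.
move=> oV Ux; elim=> [f fr|g gr|f g _ Hf _ Hg|f g _ Hf _ Hg] //=.
- exact: regular_cst.
- exact: regular_add.
- exact: regular_mul.
Qed.

Lemma open_local (X : topologicalType) (A : set X) :
  (forall x, A x -> exists V, [/\ open V, V x & V `<=` A]) -> open A.
Proof.
move=> H; rewrite openE => x Ax; have [V [oV Vx VA]] := H x Ax.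
by rewrite /interior nbhsE; exists V.
Qed.

Lemma open_slice_fst (X Y : funSpace k) (W : set (prod_space X Y)) (y : Y) :
  open W -> open [set x : X | W (x, y)].
Proof.
move=> oW; apply: open_local => x /= Wxy.
have [D [f [[U [V [oU oV eD tf]]] Dx fx Wf]]] := oW (x, y) Wxy.
rewrite eD in Dx Wf; case: Dx => /= Ux Vy.
exists (U `&` [set x | f (x, y) != 0]); split => //.
  by have [] := regular_inv oU (tensor_fun_fstr oU Vy tf).
by move=> z [Uz /= fz]; apply: Wf.
Qed.

Lemma open_slice_snd (X Y : funSpace k) (W : set (prod_space X Y)) (x : X) :
  open W -> open [set y : Y | W (x, y)].
Proof.
move=> oW; apply: open_local => y /= Wxy.
have [D [f [[U [V [oU oV eD tf]]] Dx fx Wf]]] := oW (x, y) Wxy.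
rewrite eD in Dx Wf; case: Dx => /= Ux Vy.
exists (V `&` [set y | f (x, y) != 0]); split => //.
  by have [] := regular_inv oV (tensor_fun_sndr oV Ux tf).
by move=> z [Uz /= fz]; apply: Wf.
Qed.

Variables X Y : irrSpace k.

Lemma prod_nonempty : exists p : prod_space X Y, True.
Proof.
by have [x _] := irr_nonempty X; have [y _] := irr_nonempty Y; exists (x, y).
Qed.

Lemma prod_irr_open (U V : set (prod_space X Y)) :
  open U -> open V -> U !=set0 -> V !=set0 -> U `&` V !=set0.
Proof.
move=> oU oV [[x1 y1] Up] [[x2 y2] Vp].
have [||||y [/= Uy Vy]] := @irr_open _ Y [set y | U (x1, y)] [set y | V (x2, y)].
- exact: open_slice_snd.
- exact: open_slice_snd.
- by exists y1.
- by exists y2.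
have [||||x [/= Ux Vx]] := @irr_open _ X [set x | U (x, y)] [set x | V (x, y)].
- exact: open_slice_fst.
- exact: open_slice_fst.
- by exists x1.
- by exists x2.
by exists (x, y).
Qed.

Definition prod_irr : irrSpace k := IrrSpace prod_nonempty prod_irr_open.
End ProductIrr.

Record variety (k : closedFieldType) := Variety {
  variety_space :> irrSpace k;
  variety_cover : exists (m : nat) (U : 'I_m -> set variety_space),
    (forall i, affine_open (U i)) /\ forall x, exists i, U i x;
  variety_separated :
    closed [set p : prod_space variety_space variety_space | p.1 = p.2]
}.

Section Gm.
Variable k : closedFieldType.

Definition Gm_type : Type := {a : k | a != 0}.
HB.instance Definition _ := Choice.on Gm_type.

Definition Gm_basis (D : set Gm_type) (h : Gm_type -> k) : Prop :=
  D = setT /\ exists p : {poly k}, h = fun a => p.[val a].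

Lemma Gm_basis_ax : fun_basis Gm_basis.
Proof.
split.
- move=> x; exists setT; split=> //; split=> //; exists 1.
  by apply/funext => v; rewrite hornerC.
- move=> D _ c [-> _]; split=> //; exists c%:P.
  by apply/funext => v; rewrite hornerC.
- move=> D _ _ [-> [f ->]] [_ [g ->]]; split=> //; exists (f + g).
  by apply/funext => v; rewrite hornerD.
- move=> D _ _ [-> [f ->]] [_ [g ->]]; split=> //; exists (f * g).
  by apply/funext => v; rewrite hornerM.
- by move=> D E _ _ [-> [f ->]] [-> _]; split; [rewrite setTI | exists f].
Qed.

Definition Gm_space : funSpace k := zariski_space Gm_basis_ax.

Definition Gm_one : Gm_type := exist _ 1 (oner_neq0 k).
Definition Gm_mul (g h : Gm_type) : Gm_type :=
  exist _ (val g * val h) (mulf_neq0 (valP g) (valP h)).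

Lemma Gm_nonempty : exists g : Gm_space, True.
Proof. by exists Gm_one. Qed.

Lemma Gm_irr_open (U V : set Gm_space) :
  open U -> open V -> U !=set0 -> V !=set0 -> U `&` V !=set0.
Proof.
move=> oU oV [x Ux] [y Vy].
have [D [_ [[eD [p ->]] _ px Up]]] := oU x Ux.
have [E [_ [[eE [q ->]] _ qy Vq]]] := oV y Vy.
have p0 : p != 0 by apply: contraNneq px => ->; rewrite horner0.
have q0 : q != 0 by apply: contraNneq qy => ->; rewrite horner0.
have pq0 : p * q != 0 by rewrite mulf_neq0.
have /closed_rootP[a] : size ((p * q) * 'X + 1) != 1.
  rewrite size_polyDl size_mulX // ?size_poly1 ?ltnS ?lt0n ?size_poly_eq0 //.
  by rewrite eqSS size_poly_eq0.
rewrite /root !hornerE => /eqP ea.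
have : p.[a] * q.[a] * a != 0.
  by apply/eqP => e0; move/eqP: ea; rewrite e0 add0r oner_eq0.
rewrite !mulf_eq0 !negb_or => /andP[/andP[pa qa] a0].
exists (exist _ a a0 : Gm_type); split; [apply: Up | apply: Vq] => //.
  by rewrite eD.
by rewrite eE.
Qed.

Definition Gm : irrSpace k := IrrSpace Gm_nonempty Gm_irr_open.
End Gm.

Section RationalFunctions.
Variables (k : fieldType) (X : irrSpace k).

Lemma genericallyI (P Q : set X) :
  generically P -> generically Q -> generically (P `&` Q).
Proof.
move=> [U [oU U0 UP]] [V [oV V0 VQ]]; exists (U `&` V); split.
- exact: openI.
- exact: irr_open.
- by move=> x [Ux Vx]; split; [apply: UP | apply: VQ].
Qed.

Lemma generically_sub (P Q : set X) :
  P `<=` Q -> generically P -> generically Q.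
Proof. by move=> PQ [U [oU U0 UP]]; exists U; split => // x /UP /PQ. Qed.

Lemma generically_ex (P : set X) : generically P -> exists x, P x.
Proof. by move=> [U [_ [x Ux] UP]]; exists x; apply: UP. Qed.

Record pfun := PFun {
  pdom : set X;
  pval : X -> k;
  pdom_open : open pdom;
  pdom_neq0 : pdom !=set0;
  pval_regular : regular pdom pval
}.
HB.instance Definition _ := gen_eqMixin pfun.
HB.instance Definition _ := gen_choiceMixin pfun.

Definition pfun_agree (p q : pfun) : Prop :=
  generically [set x | [/\ pdom p x, pdom q x & pval p x = pval q x]].

Lemma generically_dom p : generically (pdom p).
Proof. by exists (pdom p); split=> //; [apply: pdom_open|apply: pdom_neq0]. Qed.

Definition pfun_equiv (p q : pfun) : bool := `[< pfun_agree p q >].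

Lemma pfun_equiv_refl : reflexive pfun_equiv.
Proof.
by move=> p; apply/asboolP; apply: generically_sub (generically_dom p).
Qed.

Lemma pfun_equiv_sym : symmetric pfun_equiv.
Proof.
by move=> p q; apply: asbool_equiv_eq; split; apply: generically_sub => x [].
Qed.

Lemma pfun_equiv_trans : transitive pfun_equiv.
Proof.
move=> q p r /asboolP pq /asboolP qr; apply/asboolP.
apply: generically_sub (genericallyI pq qr) => x [[p_ _ e] [_ r_ e']].
by split=> //; rewrite e.
Qed.

Canonical pfun_equiv_rel :=
  EquivRel pfun_equiv pfun_equiv_refl pfun_equiv_sym pfun_equiv_trans.

(* The field K_X of rational functions on X. *)
Definition ratfun : Type := {eq_quot pfun_equiv_rel}%qT.
HB.instance Definition _ : EqQuotient _ pfun_equiv_rel ratfun :=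
  EqQuotient.on ratfun.
HB.instance Definition _ := Choice.on ratfun.

Definition ratclass (p : pfun) : ratfun := \pi_ratfun%qT p.

Lemma ratclassP (p q : pfun) : ratclass p = ratclass q <-> pfun_agree p q.
Proof.
split=> [/eqmodP /asboolP //|h]; by apply/eqmodP/asboolP.
Qed.

Lemma ratclass_surj (r : ratfun) : exists p, r = ratclass p.
Proof. by exists (repr r); rewrite /ratclass reprK. Qed.

Definition pcst (c : k) : pfun :=
  PFun (@openT X) (let: ex_intro x _ := irr_nonempty X in ex_intro _ x I)
    (regular_cst c (@openT X)).

Lemma pdomI_neq0 (p q : pfun) : pdom p `&` pdom q !=set0.
Proof. exact: irr_open (pdom_open p) (pdom_open q) (pdom_neq0 p) (pdom_neq0 q). Qed.

Lemma pregularl (p q : pfun) : regular (pdom p `&` pdom q) (pval p).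
Proof.
apply: regular_sub (pdom_open p) _ (@subIsetl _ _ _) (pval_regular p).
by apply: openI; apply: pdom_open.
Qed.

Lemma pregularr (p q : pfun) : regular (pdom p `&` pdom q) (pval q).
Proof. by rewrite setIC; apply: pregularl. Qed.

Definition padd (p q : pfun) : pfun :=
  PFun (openI (pdom_open p) (pdom_open q)) (pdomI_neq0 p q)
    (regular_add (openI (pdom_open p) (pdom_open q))
       (pregularl p q) (pregularr p q)).

Definition pmul (p q : pfun) : pfun :=
  PFun (openI (pdom_open p) (pdom_open q)) (pdomI_neq0 p q)
    (regular_mul (openI (pdom_open p) (pdom_open q))
       (pregularl p q) (pregularr p q)).

Definition pinv (p : pfun) : pfun :=
  if pselect (pdom p `&` [set x | pval p x != 0] !=set0) is left ne then
    PFun (proj1 (regular_inv (pdom_open p) (pval_regular p))) ne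
         (proj2 (regular_inv (pdom_open p) (pval_regular p)))
  else pcst 0.

Definition radd (r s : ratfun) : ratfun := ratclass (padd (repr r) (repr s)).
Definition rmul (r s : ratfun) : ratfun := ratclass (pmul (repr r) (repr s)).
Definition ropp (r : ratfun) : ratfun := rmul (ratclass (pcst (-1))) r.
Definition rinv (r : ratfun) : ratfun := ratclass (pinv (repr r)).

Lemma repr_ratclass (p : pfun) : pfun_agree (repr (ratclass p)) p.
Proof. by apply/ratclassP; rewrite /ratclass reprK. Qed.

Lemma raddE p q : radd (ratclass p) (ratclass q) = ratclass (padd p q).
Proof.
apply/ratclassP.
apply: generically_sub (genericallyI (repr_ratclass p) (repr_ratclass q)).
by move=> x [[p1 p2 e] [q1 q2 e']]; split=> //=; rewrite e e'.
Qed.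

Lemma rmulE p q : rmul (ratclass p) (ratclass q) = ratclass (pmul p q).
Proof.
apply/ratclassP.
apply: generically_sub (genericallyI (repr_ratclass p) (repr_ratclass q)).
by move=> x [[p1 p2 e] [q1 q2 e']]; split=> //=; rewrite e e'.
Qed.

Lemma roppE p : ropp (ratclass p) = ratclass (pmul (pcst (-1)) p).
Proof. exact: rmulE. Qed.

Ltac gen_dom p := apply: generically_sub (generically_dom p) => x px.

Lemma raddA : associative radd.
Proof.
move=> r s t; have [p ->] := ratclass_surj r; have [q ->] := ratclass_surj s.
have [u ->] := ratclass_surj t; rewrite !raddE; apply/ratclassP.
by gen_dom (padd p (padd q u)); case: px => p_ [q_ u_]; split=> //=; rewrite addrA.
Qed.

Lemma raddC : commutative radd.
Proof.
move=> r s; have [p ->] := ratclass_surj r; have [q ->] := ratclass_surj s.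
rewrite !raddE; apply/ratclassP.
by gen_dom (padd p q); case: px => p_ q_; split=> //=; rewrite addrC.
Qed.

Lemma radd0 : left_id (ratclass (pcst 0)) radd.
Proof.
move=> r; have [p ->] := ratclass_surj r; rewrite raddE; apply/ratclassP.
by gen_dom p; split=> //=; rewrite add0r.
Qed.

Lemma raddN : left_inverse (ratclass (pcst 0)) ropp radd.
Proof.
move=> r; have [p ->] := ratclass_surj r.
rewrite roppE raddE; apply/ratclassP.
by gen_dom p; split=> //=; rewrite mulN1r addNr.
Qed.

HB.instance Definition _ :=
  GRing.isZmodule.Build ratfun raddA raddC radd0 raddN.

Lemma rmulA : associative rmul.
Proof.
move=> r s t; have [p ->] := ratclass_surj r; have [q ->] := ratclass_surj s.
have [u ->] := ratclass_surj t; rewrite !rmulE; apply/ratclassP.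
by gen_dom (pmul p (pmul q u)); case: px => p_ [q_ u_]; split=> //=; rewrite mulrA.
Qed.

Lemma rmulC : commutative rmul.
Proof.
move=> r s; have [p ->] := ratclass_surj r; have [q ->] := ratclass_surj s.
rewrite !rmulE; apply/ratclassP.
by gen_dom (pmul p q); case: px => p_ q_; split=> //=; rewrite mulrC.
Qed.

Lemma rmul1 : left_id (ratclass (pcst 1)) rmul.
Proof.
move=> r; have [p ->] := ratclass_surj r; rewrite rmulE; apply/ratclassP.
by gen_dom p; split=> //=; rewrite mul1r.
Qed.

Lemma rmulDl : left_distributive rmul radd.
Proof.
move=> r s t; have [p ->] := ratclass_surj r; have [q ->] := ratclass_surj s.
have [u ->] := ratclass_surj t; rewrite raddE !rmulE raddE; apply/ratclassP.
by gen_dom (padd p (padd q u)); case: px => p_ [q_ u_]; split=> //=; rewrite mulrDl.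
Qed.

Lemma rone_neq0 : ratclass (pcst 1) != 0.
Proof.
apply/eqP => /ratclassP /generically_ex[x [_ _ /= /eqP]].
by rewrite oner_eq0.
Qed.

HB.instance Definition _ :=
  GRing.Zmodule_isComNzRing.Build ratfun rmulA rmulC rmul1 rmulDl rone_neq0.

Lemma rmulV (r : ratfun) : r != 0 -> rmul (rinv r) r = 1.
Proof.
move=> r0; rewrite -{2}(reprK r) -/(ratclass _) /rinv rmulE; apply/ratclassP.
rewrite /pinv; case: pselect => [ne|ne] /=.
  exists (pdom (repr r) `&` [set x | pval (repr r) x != 0]); split=> //.
    by have [] := regular_inv (pdom_open (repr r)) (pval_regular (repr r)).
  by move=> x [rx /= nx]; split=> //=; rewrite mulVf.
case/eqP: r0; rewrite -(reprK r); apply/ratclassP.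
gen_dom (repr r); split=> //=; apply: contrapT => /eqP nx.
by apply: ne; exists x.
Qed.

Lemma rinv0 : rinv 0 = 0.
Proof.
rewrite /rinv /pinv; case: pselect => [ne|//].
have [//|x [[_ _ e] [_ /=]]] := generically_ex (genericallyI
  (repr_ratclass (pcst 0)) (_ : generically (pdom (repr (0 : ratfun)) `&`
    [set x | pval (repr (0 : ratfun)) x != 0]))).
  exists (pdom (repr (0 : ratfun)) `&`
    [set x | pval (repr (0 : ratfun)) x != 0]); split=> //.
  by have [] := regular_inv (pdom_open (repr (0 : ratfun)))
    (pval_regular (repr (0 : ratfun))).
by rewrite e eqxx.
Qed.

HB.instance Definition _ :=
  GRing.ComNzRing_isField.Build ratfun rmulV rinv0.

End RationalFunctions.

Section RationalMaps.
Variable k : fieldType.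

(* A pair representing a rational map from X to Y. *)
Record ratmap (X Y : irrSpace k) := RatMap {
  rdom : set X;
  rmap : X -> Y;
  rdom_open : open rdom;
  rdom_neq0 : rdom !=set0;
  rmap_morphism : morphism_on rdom rmap
}.

Definition ratmap_eq (X Y : irrSpace k) (f g : ratmap X Y) : Prop :=
  generically [set x | [/\ rdom f x, rdom g x & rmap f x = rmap g x]].

(* The rational map f is defined at x, with value y; f is considered on its
   largest domain of definition. *)
Definition ratmap_at (X Y : irrSpace k) (f : ratmap X Y) (x : X) (y : Y) :
    Prop :=
  exists g : ratmap X Y, [/\ ratmap_eq f g, rdom g x & rmap g x = y].

Section Pullback.
Variables (X Y : irrSpace k) (f : ratmap X Y) (p : pfun Y).

Definition pull_dom : set X := rdom f `&` rmap f @^-1` pdom p.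

Definition pull_pfun (ne : pull_dom !=set0) : pfun X :=
  PFun (proj1 (rmap_morphism f (pdom_open p) (pval_regular p))) ne
       (proj2 (rmap_morphism f (pdom_open p) (pval_regular p))).
End Pullback.

(* The class of r \o f; the value 0 is never used when f is dominant. *)
Definition pullback (X Y : irrSpace k) (f : ratmap X Y) (r : ratfun Y) :
    ratfun X :=
  if pselect (pull_dom f (repr r) !=set0) is left ne
  then ratclass (pull_pfun ne) else 0.

Lemma snd_morphism (X Y : irrSpace k) :
  @morphism_on k (prod_irr X Y) Y setT (fun p => p.2).
Proof.
move=> V h oV hV; rewrite setTI.
have BT (g : Y -> k) : regular V g ->
    prod_basis (X := X) (Y := Y) (setT `*` V) (fun p => g p.2).
  move=> gV; exists setT, V; split; [exact: openT|by []|by []|].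
  exact: tensor_snd.
have one_V : regular V (fun=> 1) by apply: regular_cst.
split.
- change (zariski_open (@prod_basis k X Y) (snd @^-1` V)) => p Vp.
  exists (setT `*` V), (fun=> 1); split=> //; first exact: (BT (fun=> 1)).
    exact: oner_neq0.
  by move=> q [].
- move=> p Vp.
  exists (setT `*` V), (fun q => h q.2), (fun=> 1); split=> //.
  + exact: BT.
  + exact: (BT (fun=> 1)).
  + exact: oner_neq0.
  + by move=> *; rewrite divr1.
Qed.

Lemma setT_neq0 (X : irrSpace k) : [set: X] !=set0.
Proof. by have [x _] := irr_nonempty X; exists x. Qed.

Definition snd_ratmap (X Y : irrSpace k) : ratmap (prod_irr X Y) Y :=
  RatMap (@openT (prod_irr X Y)) (setT_neq0 (prod_irr X Y))
    (@snd_morphism X Y).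
End RationalMaps.

Local Notation "x %:F" := (tofrac x).

Section OneVariable.
Variable K : fieldType.

(* r = a / b in K(t), seen as the fraction field of K[t]. *)
Definition frac_repr (r : {fraction {poly K}}) (a b : {poly K}) : Prop :=
  b != 0 /\ r = a%:F / b%:F.

Definition frac_deriv (r : {fraction {poly K}}) : {fraction {poly K}} :=
  xget 0 [set d | exists a b, frac_repr r a b /\
                  d = (a^`() * b - a * b^`())%:F / (b ^+ 2)%:F].

(* The value at c of r in the local ring { r | ord_c r >= 0 } of K(t). *)
Definition frac_ev (c : K) (r : {fraction {poly K}}) : K :=
  xget 0 [set v | exists a b, [/\ frac_repr r a b, b.[c] != 0 &
                  v = a.[c] / b.[c]]].

Definition gen_subfield (A : set K) : set K :=
  [set x | forall S : {pred K}, GRing.divring_closed S ->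
           (forall a, A a -> a \in S) -> x \in S].

Definition transcendental_over (F : set K) (s : K) : Prop :=
  forall p : {poly K}, (forall i, F p`_i) -> p.[s] = 0 -> p = 0.

Definition derivation_over (F : set K) (D : K -> K) : Prop :=
  [/\ forall a b, D (a + b) = D a + D b,
      forall a b, D (a * b) = D a * b + a * D b &
      forall a, F a -> D a = 0].

(* D = s d/ds, the F-derivation of F(s) sending s to s. *)
Definition is_s_dds (F : set K) (s : K) (D : K -> K) : Prop :=
  derivation_over F D /\ D s = s.
End OneVariable.

Section RationalAction.
Variables (k : closedFieldType) (X : variety k).
Local Notation KX := (ratfun X).
Local Notation GmX := (prod_irr (Gm k) X).

Definition rational_Gm_action (phi : ratmap GmX X) : Prop :=
  generically (fun q : prod_irr (Gm k) GmX =>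
    exists2 y, ratmap_at phi (q.2.1, q.2.2) y &
    exists2 z, ratmap_at phi (q.1, y) z &
               ratmap_at phi (Gm_mul q.1 q.2.1, q.2.2) z) /\
  generically (fun x : X => ratmap_at phi (Gm_one k, x) x).

(* Injectivity of g |-> phi_g, where phi_g = phi (g, -) in Bir(X). *)
Definition faithful_Gm_action (phi : ratmap GmX X) : Prop :=
  forall g h : Gm k,
    generically (fun x : X => exists2 y, ratmap_at phi (g, x) y &
                                         ratmap_at phi (h, x) y) ->
    g = h.

Lemma Gm_coord_regular : @regular k GmX setT (fun p => val p.1).
Proof.
have vr : @regular k (Gm k) setT (fun a => val a).
  move=> a _; exists setT, (fun a => val a), (fun=> 1); split=> //.
  - by split=> //; exists 'X; apply/funext => b; rewrite hornerX.
  - by split=> //; exists 1; apply/funext => b; rewrite hornerC.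
  - exact: oner_neq0.
  - by move=> *; rewrite divr1.
have BT h : tensor_fun (X := Gm k) (Y := X) setT setT h -> prod_basis setT h.
  by move=> th; exists setT, setT; split=> //; [exact: openT..|rewrite setXTT].
move=> p _; exists setT, (fun p => val p.1), (fun=> 1); split=> //.
- by apply: BT; apply: (tensor_fst _ vr).
- apply: BT; apply: (@tensor_fst _ _ _ _ _ (fun=> 1)).
  by apply: regular_cst; apply: openT.
- exact: oner_neq0.
- by move=> *; rewrite divr1.
Qed.

(* The coordinate t of Gm, as a rational function on Gm * X. *)
Definition Gm_coord : ratfun GmX :=
  ratclass (PFun (@openT GmX) (setT_neq0 GmX) Gm_coord_regular).

(* The evaluation K_X[t] -> k(Gm * X), and its extension to K_X(t). *)
Definition poly_to_ratfun (p : {poly KX}) : ratfun GmX :=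
  (map_poly (pullback (snd_ratmap (Gm k) X)) p).[Gm_coord].

Definition is_frac_ratfun (r : {fraction {poly KX}}) (f : ratfun GmX) : Prop :=
  exists a b, frac_repr r a b /\ f = poly_to_ratfun a / poly_to_ratfun b.

Variable phi : ratmap GmX X.

(* phi^* : K_X -> k(Gm * X) = K_X(t). *)
Definition comorphism (f : KX) : {fraction {poly KX}} :=
  xget 0 [set r | is_frac_ratfun r (pullback phi f)].

Definition invariants : set KX := [set f | comorphism f = (f%:P)%:F].

Definition rational_slice (s : KX) : Prop :=
  comorphism s = 'X%:F * (s%:P)%:F.

Definition action_derivation (f : KX) : KX :=
  frac_ev 1 (frac_deriv (comorphism f)).

Definition derivation_kernel : set KX := [set f | action_derivation f = 0].
End RationalAction.

(* Main.v *)
Require Import Defs.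
From HB Require Import structures.
From mathcomp Require Import all_boot all_order all_algebra fraction.
From mathcomp Require Import generic_quotient ring.
From mathcomp Require Import boolp classical_sets topology_structure.

(** Write [phi^*f = r(t)] with [r] in [K_X(t)].  Associativity of the action
    says that applying [phi^*] to the coefficients of [r(t)] yields [r(u t)],
    where [u] is the coordinate of [Gm]; since [phi^*s = u s], the coefficients
    of [r(t / s)] do not change under [phi^*].  Hence [r(t / s) = a(t) / b(t)]
    with [a] and [b] coprime and [b] monic, so that the coefficients of [a] and
    [b] are invariants.  Then [phi^*f = a(u s) / b(u s) = phi^*(a(s) / b(s))],
    and [f = a(s) / b(s)] because [phi^*] is injective.  Moreover [r(t)] is
    [a(t s) / b(t s)], whose denominator does not vanish at [t = 1] because [s]
    is transcendental over the invariants: this makes the derivation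
    computable. *)

Set Implicit Arguments.
Unset Strict Implicit.
Unset Printing Implicit Defensive.

Import GRing.Theory.
Local Open Scope classical_set_scope.
Local Open Scope ring_scope.

(** * Rational functions handled through their values at generic points *)

Section Values.
Variables (k : fieldType) (X : irrSpace k).

Lemma generically_all (P : set X) : (forall x, P x) -> generically P.
Proof.
move=> PT; exists setT; split; [exact: openT|exact: setT_neq0|].
by move=> x _.
Qed.

Lemma generically_forall n (P : nat -> set X) :
  (forall i, generically (P i)) -> generically [set x | forall i, (i < n)%N -> P i x].
Proof.
move=> gP; elim: n => [|n IHn]; first exact: generically_all.
apply: generically_sub (genericallyI IHn (gP n)) => x [Px Pn] i.
by rewrite ltnS leq_eqVlt => /orP[/eqP->|/Px].
Qed.

(* A junk value outside the domain of the chosen representative. *)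
Definition ratval (f : ratfun X) (x : X) : k := pval (repr f) x.

Lemma ratval_class (p : pfun X) :
  generically [set x | pdom p x /\ ratval (ratclass p) x = pval p x].
Proof. by apply: generically_sub (repr_ratclass p) => x [_ ? ?]; split. Qed.

Lemma ratval_inj (f g : ratfun X) :
  generically [set x | ratval f x = ratval g x] -> f = g.
Proof.
move=> fg; rewrite -[f]reprK -[g]reprK; apply/ratclassP.
apply: generically_sub (genericallyI fg (genericallyI
  (generically_dom (repr f)) (generically_dom (repr g)))).
by move=> x [? [? ?]]; split.
Qed.

Definition ratcst (c : k) : ratfun X := ratclass (pcst X c).

Lemma ratval_cst c : generically [set x | ratval (ratcst c) x = c].
Proof. by apply: generically_sub (ratval_class (pcst X c)) => x []. Qed.

Lemma ratvalD (f g : ratfun X) :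
  generically [set x | ratval (f + g) x = ratval f x + ratval g x].
Proof. by apply: generically_sub (ratval_class (padd (repr f) (repr g))) => x []. Qed.

Lemma ratvalM (f g : ratfun X) :
  generically [set x | ratval (f * g) x = ratval f x * ratval g x].
Proof. by apply: generically_sub (ratval_class (pmul (repr f) (repr g))) => x []. Qed.

Lemma ratval_exp (f : ratfun X) n :
  generically [set x | ratval (f ^+ n) x = ratval f x ^+ n].
Proof.
elim: n => [|n IHn]; first by rewrite expr0; apply: ratval_cst.
apply: generically_sub (genericallyI IHn (ratvalM f (f ^+ n))) => x /= [e].
by rewrite !exprS => ->; rewrite e.
Qed.

Lemma ratval_sum n (F : nat -> ratfun X) :
  generically [set x | ratval (\sum_(i < n) F i) x = \sum_(i < n) ratval (F i) x].
Proof.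
elim: n => [|n IHn].
  by apply: generically_sub (ratval_cst 0) => x /=; rewrite !big_ord0.
apply: generically_sub (genericallyI IHn (ratvalD (\sum_(i < n) F i) (F n))).
by move=> x /= [e]; rewrite !big_ord_recr /= e.
Qed.

Lemma ratcst_is_semi_additive : ratcst 0 = 0 /\ {morph ratcst : a b / a + b}.
Proof.
split=> // a b; apply/ratval_inj.
apply: generically_sub (genericallyI (ratvalD (ratcst a) (ratcst b))
  (genericallyI (ratval_cst (a + b)) (genericallyI (ratval_cst a) (ratval_cst b)))).
by move=> x /= [-> [-> [-> ->]]].
Qed.

Lemma ratcst_is_monoid : monoid_morphism ratcst.
Proof.
split=> // a b; apply/ratval_inj.
apply: generically_sub (genericallyI (ratvalM (ratcst a) (ratcst b))
  (genericallyI (ratval_cst (a * b)) (genericallyI (ratval_cst a) (ratval_cst b)))).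
by move=> x /= [-> [-> [-> ->]]].
Qed.

HB.instance Definition _ := GRing.isNmodMorphism.Build k (ratfun X) ratcst
  ratcst_is_semi_additive.
HB.instance Definition _ := GRing.isMonoidMorphism.Build k (ratfun X) ratcst
  ratcst_is_monoid.

(** Meaningful for generic [x] only, as each coefficient is read through [ratval]; the degree may
    drop at special points. *)
Definition poly_at (a : {poly ratfun X}) (x : X) : {poly k} :=
  \poly_(i < size a) ratval a`_i x.

Lemma ratval_horner (a : {poly ratfun X}) (z : ratfun X) :
  generically [set x | ratval a.[z] x = (poly_at a x).[ratval z x]].
Proof.
have H i : generically [set x | ratval (a`_i * z ^+ i) x =
    ratval a`_i x * ratval z x ^+ i].
  apply: generically_sub (genericallyI (ratvalM a`_i (z ^+ i)) (ratval_exp z i)).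
  by move=> x /= [-> ->].
apply: generically_sub (genericallyI (ratval_sum (size a) (fun i => a`_i * z ^+ i))
  (generically_forall (size a) H)) => x /= [e h].
rewrite horner_coef e horner_poly; apply: eq_bigr => i _; exact: h.
Qed.

Lemma poly_at_eq0 (a : {poly ratfun X}) :
  generically [set x | poly_at a x = 0] -> a = 0.
Proof.
move=> a0; apply/polyP => i; rewrite coef0.
have [/(nth_default 0)//|lt_i] := leqP (size a) i.
apply/ratval_inj; apply: generically_sub (genericallyI a0 (ratval_cst 0)).
by move=> x /= [/polyP/(_ i) + ->]; rewrite coef_poly lt_i coef0.
Qed.
End Values.

(** * Pullback along a dominant rational map is a field morphism *)

Section Pullback.
Variables (k : fieldType) (X Y : irrSpace k) (f : ratmap X Y).

Definition dominant : Prop := forall V : set Y, open V -> V !=set0 ->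
  rdom f `&` rmap f @^-1` V !=set0.

Hypothesis f_dom : dominant.

Lemma generically_preimage (P : set Y) : generically P ->
  generically (rdom f `&` rmap f @^-1` P).
Proof.
move=> [V [oV V0 VP]]; exists (rdom f `&` rmap f @^-1` V); split.
(* Continuity is the case of a constant function in [morphism_on]. *)
- by have [] := rmap_morphism f oV (regular_cst 1 oV).
- exact: f_dom.
- by move=> x [? /VP]; split.
Qed.

(** The dominance proof is an argument so that the ring morphism structure can be attached to this
    constant: for a general [f], [pullback f] may take its default value 0. *)
Definition dom_pullback of dominant := pullback f.
Local Notation fstar := (dom_pullback f_dom).

Lemma ratval_pullback r :
  generically [set x | ratval (fstar r) x = ratval r (rmap f x)].
Proof.
rewrite /dom_pullback /pullback; case: pselect => [ne|[]].
  by apply: generically_sub (ratval_class (pull_pfun ne)) => x [].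
exact/f_dom/pdom_neq0/pdom_open.
Qed.

Lemma pullback_is_semi_additive : fstar 0 = 0 /\ {morph fstar : a b / a + b}.
Proof.
split.
  apply/ratval_inj; apply: generically_sub (genericallyI (ratval_pullback 0)
    (genericallyI (ratval_cst _ 0) (generically_preimage (ratval_cst _ 0)))).
  by move=> x /= [-> [-> []]].
move=> a b; apply/ratval_inj.
apply: generically_sub (genericallyI (genericallyI (ratval_pullback a)
   (ratval_pullback b)) (genericallyI (ratval_pullback (a + b))
   (genericallyI (ratvalD (fstar a) (fstar b))
   (generically_preimage (ratvalD a b))))).
by move=> x /= [[ea eb] [-> [-> [_ ->]]]]; rewrite ea eb.
Qed.

Lemma pullback_is_monoid : monoid_morphism fstar.
Proof.
split.
  apply/ratval_inj; apply: generically_sub (genericallyI (ratval_pullback 1)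
    (genericallyI (ratval_cst _ 1) (generically_preimage (ratval_cst _ 1)))).
  by move=> x /= [-> [-> []]].
move=> a b; apply/ratval_inj.
apply: generically_sub (genericallyI (genericallyI (ratval_pullback a)
   (ratval_pullback b)) (genericallyI (ratval_pullback (a * b))
   (genericallyI (ratvalM (fstar a) (fstar b))
   (generically_preimage (ratvalM a b))))).
by move=> x /= [[ea eb] [-> [-> [_ ->]]]]; rewrite ea eb.
Qed.

HB.instance Definition _ := GRing.isNmodMorphism.Build (ratfun Y) (ratfun X) fstar
  pullback_is_semi_additive.
HB.instance Definition _ := GRing.isMonoidMorphism.Build (ratfun Y) (ratfun X) fstar
  pullback_is_monoid.

Lemma poly_at_pullback (a : {poly ratfun Y}) :
  generically [set x | poly_at (map_poly fstar a) x = poly_at a (rmap f x)].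
Proof.
apply: generically_sub (generically_forall (size a) (fun i => ratval_pullback a`_i)).
move=> x h; rewrite /poly_at size_map_poly; apply: eq_poly => i lt_i.
by rewrite coef_map /= h.
Qed.
End Pullback.

(** * Values of rational maps into a separated target *)

Section Separated.
Variables (k : closedFieldType) (X : irrSpace k) (Y : variety k).

(** If the values at [x] differed, the pair would have a basic neighbourhood off the diagonal, cut
    out by a tensor function [h]. The pullback of [h] along [(f, g)] is regular, so that
    neighbourhood pulls back to a nonempty open set, which meets the generic locus where [f] and [g]
    agree. *)
Lemma ratmap_eq_on (f g : ratmap X Y) x :
  ratmap_eq f g -> rdom f x -> rdom g x -> rmap f x = rmap g x.
Proof.
move=> fg fx gx; apply: contrapT => ne.
have /(_ (rmap f x, rmap g x) ne) : open (~` [set p : prod_space Y Y | p.1 = p.2]).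
  exact/closed_openC/variety_separated.
move=> [_ [h [[A [B [oA oB -> th]]] [/= Ax Bx] hx sub]]].
have [oU _] := rmap_morphism f oA (regular_cst 1 oA).
have [oV _] := rmap_morphism g oB (regular_cst 1 oB).
set U := rdom f `&` rmap f @^-1` A in oU; set V := rdom g `&` rmap g @^-1` B in oV.
have hr : regular (U `&` V) (fun y => h (rmap f y, rmap g y)).
  elim: th => [a ar|b br|a b _ Ha _ Hb|a b _ Ha _ Hb] /=.
  - have [_ r] := rmap_morphism f oA ar.
    by apply: (regular_sub oU _ _ r); [exact: openI|exact: subIsetl].
  - have [_ r] := rmap_morphism g oB br.
    by apply: (regular_sub oV _ _ r); [exact: openI|exact: subIsetr].
  - by apply: regular_add => //; exact: openI.
  - by apply: regular_mul => //; exact: openI.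
have [oW _] := regular_inv (openI oU oV) hr.
have gW : generically (U `&` V `&` [set y | h (rmap f y, rmap g y) != 0]).
  by exists (U `&` V `&` [set y | h (rmap f y, rmap g y) != 0]); split=> //; exists x.
have [y [[[[_ Ay] [_ By]] /= hy] [_ _ e]]] := generically_ex (genericallyI gW fg).
exact: (sub (rmap f y, rmap g y)).
Qed.

(** Thus [ratmap_at], which ranges over all representatives, can be computed with [f] itself
    wherever [f] is defined. *)
Lemma ratmap_atE (f : ratmap X Y) x y : rdom f x -> ratmap_at f x y -> y = rmap f x.
Proof. by move=> fx [g [fg gx <-]]; rewrite (ratmap_eq_on fg fx gx). Qed.
End Separated.

(** * Derivatives and values of rational fractions in one variable *)

Section RationalFractions.
Variable K : fieldType.
Local Notation "x %:F" := (tofrac x).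

Lemma tofrac_divP (a b c d : {poly K}) : b != 0 -> d != 0 ->
  a%:F / b%:F = c%:F / d%:F <-> a * d = c * b.
Proof.
move=> b0 d0.
rewrite -tofrac_eq0 in b0; rewrite -tofrac_eq0 in d0.
split=> [/eqP|e].
  by rewrite (eqr_div _ _ b0 d0) -(tofracM a d) -(tofracM c b) tofrac_eq => /eqP.
by apply/eqP; rewrite (eqr_div _ _ b0 d0) -(tofracM a d) -(tofracM c b) e.
Qed.

(** [frac_deriv] chooses a representation, so the point is independence of the choice: it follows
    from differentiating [a * d = c * b]. *)
Lemma frac_derivE (a b : {poly K}) : b != 0 ->
  frac_deriv (a%:F / b%:F) = (a^`() * b - a * b^`())%:F / (b ^+ 2)%:F.
Proof.
move=> b0; rewrite /frac_deriv; case: xgetP => [_ -> [c [d [[d0 e] ->]]]|]; last first.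
  move=> /(_ ((a^`() * b - a * b^`())%:F / (b ^+ 2)%:F)) [].
  by exists a, b; split.
have {}e : a * d - c * b = 0.
  by apply/eqP; rewrite subr_eq0; apply/eqP/tofrac_divP.
have e' : a^`() * d + a * d^`() - (c^`() * b + c * b^`()) = 0.
  by rewrite -!derivM -derivB e linear0.
apply/tofrac_divP; rewrite ?expf_neq0 //.
apply/eqP; rewrite eq_sym -subr_eq0; apply/eqP.
(* The difference of the cross products is a combination of the left-hand sides of [e'] and [e]. *)
transitivity (b * d * (a^`() * d + a * d^`() - (c^`() * b + c * b^`()))
  - (a * d - c * b) * (b^`() * d + b * d^`())); first by ring.
by rewrite e e' mulr0 mul0r subr0.
Qed.

Lemma frac_evE c (a b : {poly K}) : b.[c] != 0 ->
  frac_ev c (a%:F / b%:F) = a.[c] / b.[c].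
Proof.
have nz (p : {poly K}) : p.[c] != 0 -> p != 0.
  by apply: contraNneq => ->; rewrite horner0.
move=> bc; rewrite /frac_ev; case: xgetP => [_ -> [p [q [[q0 e] qc ->]]]|]; last first.
  by move=> /(_ (a.[c] / b.[c])) []; exists a, b; split=> //; split=> //; exact: nz.
move/(tofrac_divP _ _ (nz _ bc) q0): e => /(congr1 (fun r => r.[c])).
by rewrite !hornerM => e; apply/eqP; rewrite eqr_div // e.
Qed.

(** The quotient rule for [a / b], evaluated at [c]. It lives in [K], where the sum and product
    rules become field identities. *)
Definition quotient_deriv_at c (a b : {poly K}) : K :=
  (a^`().[c] * b.[c] - a.[c] * b^`().[c]) / b.[c] ^+ 2.

Lemma quotient_deriv_atD z (a b c d : {poly K}) : b.[z] != 0 -> d.[z] != 0 ->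
  quotient_deriv_at z (a * d + c * b) (b * d) =
  quotient_deriv_at z a b + quotient_deriv_at z c d.
Proof.
move=> b0 d0; rewrite /quotient_deriv_at derivD !derivM !(hornerD, hornerM).
by field; rewrite b0 d0.
Qed.

Lemma quotient_deriv_atM z (a b c d : {poly K}) : b.[z] != 0 -> d.[z] != 0 ->
  quotient_deriv_at z (a * c) (b * d) =
  quotient_deriv_at z a b * (c.[z] / d.[z]) + a.[z] / b.[z] * quotient_deriv_at z c d.
Proof.
move=> b0 d0; rewrite /quotient_deriv_at !derivM !(hornerD, hornerM).
by field; rewrite b0 d0.
Qed.

Lemma quotient_deriv_atZ z (c : K) (p : {poly K}) :
  quotient_deriv_at z (p * c%:P) 1 = p^`().[z] * c.
Proof.
rewrite /quotient_deriv_at derivM !derivC mulr0 addr0 hornerM !hornerC ?horner0.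
by rewrite mulr0 subr0 expr1n divr1 mulr1.
Qed.
End RationalFractions.

(** A reduced fraction with monic denominator is unique, and field morphisms preserve both
    properties: [map_poly P b] divides [map_poly S b] by Gauss's lemma, and both are monic of the
    same size. *)
Lemma coprime_monic_fixed (K L : fieldType) (P S : {rmorphism K -> L})
    (a b : {poly K}) : coprimep a b -> b \is monic ->
  map_poly P a * map_poly S b = map_poly S a * map_poly P b ->
  map_poly P a = map_poly S a /\ map_poly P b = map_poly S b.
Proof.
move=> cab mb e.
have eb : map_poly P b = map_poly S b.
  apply/eqP; rewrite -eqp_monic ?map_monic // -dvdp_size_eqp ?size_map_poly //.
  rewrite -(@Gauss_dvdpr _ _ (map_poly P a)) ?e ?dvdp_mull //.
  by rewrite coprimep_sym coprimep_map.
split=> //; move: e; rewrite eb; apply: mulIf.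
by rewrite map_poly_eq0 monic_neq0.
Qed.

(** * The slice argument in abstract form: [P] stands for [phi^*], [S] for [pr_2^*], [u] for the
    coordinate of [Gm] *)

Section Slice.
Variables (K L : fieldType) (P S : {rmorphism K -> L}) (u : L).
Local Notation ev p := (map_poly S p).[u].

Hypothesis ev_eq0 : forall a, ev a = 0 -> a = 0.
Hypothesis ev_frac : forall z, exists a b, b != 0 /\ z = ev a / ev b.
(* If [P f] is the fraction [r(u)], then applying [P] to the coefficients of
   [r(t)] gives [r(u t)]. *)
Hypothesis coaction : forall f a b, P f * ev b = ev a ->
  map_poly P a * (map_poly S b \Po (u *: 'X)) =
  (map_poly S a \Po (u *: 'X)) * map_poly P b.
Variable s : K.
Hypotheses (s_neq0 : s != 0) (Ps : P s = u * S s).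

(** Applying [P] to [p.[s] = 0] gives a relation at [u * S s], that is, [p (s t)] vanishes at
    [t = u]. As [u] is transcendental over the image of [S], [p (s t) = 0], and [s] is
    invertible. *)
Lemma slice_transcendental (p : {poly K}) :
  map_poly P p = map_poly S p -> p.[s] = 0 -> p = 0.
Proof.
move=> Pp p0.
have : p \Po (s *: 'X) = 0.
  apply: ev_eq0; rewrite map_comp_poly map_polyZ map_polyX horner_comp !hornerE.
  by rewrite mulrC -Ps -Pp horner_map p0 rmorph0.
move/eqP; rewrite comp_poly_eq0 ?size_scale ?size_polyX //.
by move/eqP.
Qed.

Lemma slice_generates f : exists a b : {poly K},
  [/\ map_poly P a = map_poly S a, map_poly P b = map_poly S b,
      b.[s] != 0 & f = a.[s] / b.[s]].
Proof.
have [a [b [b0 Pf]]] := ev_frac (P f).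
have evb : ev b != 0 by apply: contraNneq b0 => /ev_eq0->.
have {}Pf : P f * ev b = ev a by rewrite Pf mulfVK.
have Ps0 : P s != 0 by rewrite fmorph_eq0.
have Ss0 : S s != 0 by rewrite fmorph_eq0.
have u0 : u != 0 by apply: contraNneq Ps0 => u0; rewrite Ps u0 mul0r.
(* The substitution of [t / s] for [t]. *)
pose inv p := p \Po (s^-1 *: 'X).
have invK p : inv p \Po (s *: 'X) = p.
  rewrite -comp_polyA comp_polyZ comp_polyX scalerA mulVf // scale1r.
  by rewrite comp_polyXr.
have inv_fixed : map_poly P (inv a) * map_poly S (inv b) =
                 map_poly S (inv a) * map_poly P (inv b).
  (* Substitute [t / (u * S s)] for [t]: [u t] becomes [t / S s], and [u * S s] is [P s], so only
     images of [inv a] and [inv b] remain. *)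
  have := congr1 (fun p => p \Po ((u * S s)^-1 *: 'X)) (coaction Pf).
  have SE p : (map_poly S p \Po (u *: 'X)) \Po ((u * S s)^-1 *: 'X) =
      map_poly S (inv p).
    rewrite -comp_polyA comp_polyZ comp_polyX scalerA invfM mulrA mulfV // mul1r.
    by rewrite map_comp_poly map_polyZ map_polyX /= fmorphV.
  have PE p : map_poly P p \Po ((u * S s)^-1 *: 'X) = map_poly P (inv p).
    by rewrite map_comp_poly map_polyZ map_polyX /= fmorphV Ps.
  by rewrite !comp_polyM !SE !PE.
have invb0 : inv b != 0.
  by apply: contraNneq b0 => e; rewrite -[b]invK e comp_poly0.
(* Dividing by the gcd, then by the leading coefficient of the denominator, gives the normal form
   that [coprime_monic_fixed] requires. *)
pose d := gcdp (inv a) (inv b).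
have d0 : d != 0 by rewrite gcdp_eq0 (negPf invb0) andbF.
have ea : inv a = (inv a %/ d) * d by rewrite divpK ?dvdp_gcdl.
have eb : inv b = (inv b %/ d) * d by rewrite divpK ?dvdp_gcdr.
have cab : coprimep (inv a %/ d) (inv b %/ d).
  by rewrite coprimep_div_gcd // invb0 orbT.
move: (inv a %/ d) (inv b %/ d) cab ea eb => p q cpq ea eb.
have q0 : q != 0 by apply: contraNneq invb0 => q0; rewrite eb q0 mul0r.
have l0 : (lead_coef q)^-1 != 0 by rewrite invr_eq0 lead_coef_eq0.
set l := (lead_coef q)^-1 in l0.
have [|||ep eq] := @coprime_monic_fixed _ _ P S (l *: p) (l *: q).
- by rewrite coprimepZl // coprimepZr.
- by rewrite monicE lead_coefZ mulVf // lead_coef_eq0.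
- rewrite !map_polyZ -!scalerAl -!scalerAr !scalerA; congr (_ *: _); first exact: mulrC.
  move: inv_fixed; rewrite ea eb !rmorphM /= => e.
  have dd0 : map_poly P d * map_poly S d != 0 by rewrite mulf_neq0 ?map_poly_eq0.
  apply: (mulIf dd0); transitivity
    (map_poly P p * map_poly P d * (map_poly S q * map_poly S d)); first by ring.
  by rewrite e; ring.
have qs0 : (l *: q).[s] != 0.
  apply: contraNneq q0 => /(slice_transcendental eq)/eqP.
  by rewrite scaler_eq0 (negPf l0) => /eqP->.
exists (l *: p), (l *: q); split=> //.
(* By injectivity of [P] it suffices to compare in [L], where the value of [r] at [u] is that of
   [inv r] at [u * S s = P s]. *)
apply: (fmorph_inj P); rewrite fmorph_div /=.
have evE r : ev r = (map_poly S (inv r)).[u * S s].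
  rewrite -{1}[r]invK map_comp_poly map_polyZ map_polyX horner_comp !hornerE.
  by rewrite mulrC.
have eS r : map_poly P (l *: r) = map_poly S (l *: r) ->
    S l * (map_poly S r).[u * S s] = P (l *: r).[s].
  by move=> e; rewrite -horner_map e /= Ps map_polyZ hornerZ.
apply: (canRL (mulfK _)); first by rewrite fmorph_eq0.
rewrite -!eS //; move: Pf evb; rewrite !evE ea eb !rmorphM /= !hornerM.
rewrite mulf_eq0 negb_or => + /andP[_ Sd0] => Pf.
apply: (mulIf Sd0); rewrite -[RHS]mulrA -Pf; ring.
Qed.
End Slice.

(** * Generic points of [Gm] *)

Section GmGeneric.
Variable k : closedFieldType.

Lemma generically_nonroot (p : {poly k}) : p != 0 ->
  generically [set g : Gm k | p.[val g] != 0].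
Proof.
move=> p0; exists [set g : Gm k | p.[val g] != 0]; split=> //.
  move=> g pg; exists setT, (fun h => p.[val h]); split=> //.
  by split=> //; exists p.
(* A root [a] of [p * 'X + 1] satisfies [p.[a] * a = -1], so it is nonzero and not a root of [p]. *)
have /closed_rootP[a] : size (p * 'X + 1) != 1.
  rewrite size_polyDl size_mulX // ?size_poly1 ?ltnS ?lt0n ?size_poly_eq0 //.
  by rewrite eqSS size_poly_eq0.
rewrite /root !hornerE => ea.
have : p.[a] * a != 0.
  by apply: contraTneq ea => ->; rewrite add0r oner_eq0.
rewrite mulf_eq0 negb_or => /andP[pa a0].
by exists (exist _ a a0).
Qed.

Lemma generically_translate (c : Gm k) (P : set (Gm k)) : generically P ->
  generically [set g : Gm k | P (Gm_mul c g)].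
Proof.
move=> [W [oW [w Ww] WP]]; exists [set g : Gm k | W (Gm_mul c g)]; split.
- move=> g Wg; have [D [_ [[eD [p ->]] _ pg Wp]]] := oW _ Wg.
  have eq_p h : (p \Po (val c *: 'X)).[val h] = p.[val (Gm_mul c h)].
    by rewrite horner_comp !hornerE.
  exists setT, (fun h => (p \Po (val c *: 'X)).[val h]); split=> //.
  + by split=> //; exists (p \Po (val c *: 'X)).
  + by rewrite eq_p.
  + by move=> h _; rewrite eq_p => /Wp; apply; rewrite eD.
- exists (exist _ ((val c)^-1 * val w) (mulf_neq0 (invr_neq0 (valP c)) (valP w))).
  rewrite /= (_ : Gm_mul _ _ = w) //.
  by apply: val_inj; rewrite /= mulVKf // (valP c).
- by move=> g /WP.
Qed.

Lemma generically_many (P : set (Gm k)) n : generically P ->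
  exists rs : seq k, [/\ size rs = n, uniq rs &
    forall r, r \in rs -> exists2 g : Gm k, P g & val g = r].
Proof.
move=> gP; elim: n => [|n [rs [<- urs Prs]]]; first by exists [::].
have p0 : \prod_(r <- rs) ('X - r%:P) != 0 by rewrite monic_neq0 ?monic_prod_XsubC.
have [g [Pg]] := generically_ex (genericallyI gP (generically_nonroot p0)).
rewrite /= -[_ == 0]/(root _ _) root_prod_XsubC => g_rs.
exists (val g :: rs); split=> //=; first by rewrite g_rs.
by move=> r; rewrite inE => /predU1P[->|/Prs //]; exists g.
Qed.

(** A generic subset of [Gm] contains [size Q] distinct points, and [i] is injective: too many roots
    for a nonzero [Q]. *)
Lemma poly_eq0_generically (L : fieldType) (i : {rmorphism k -> L}) (Q : {poly L}) :
  generically [set g : Gm k | Q.[i (val g)] = 0] -> Q = 0.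
Proof.
move=> /(@generically_many _ (size Q))[rs [srs urs Qrs]].
apply/eqP; apply: contraT => /max_poly_roots/(_ (_ : all (root Q) (map i rs))).
rewrite map_inj_uniq ?size_map ?srs ?ltnn; last exact: fmorph_inj.
by apply=> //; apply/allP => _ /mapP[r /Qrs[g Qg <-] ->]; apply/eqP.
Qed.
End GmGeneric.

(** * Slices of generic subsets of a product *)

Section Slices.
Variables (k : fieldType) (X Y : irrSpace k) (P : set (prod_irr X Y)).

Lemma generically_slice_fst : generically P ->
  generically [set x : X | generically [set y : Y | P (x, y)]].
Proof.
move=> [W [oW [[x0 y0] W0] WP]].
exists [set x | W (x, y0)]; split; [exact: open_slice_fst|by exists x0|].
move=> x Wx; exists [set y | W (x, y)]; split; [exact: open_slice_snd|by exists y0|].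
by move=> y /WP.
Qed.

Lemma generically_slice_snd : generically P ->
  generically [set y : Y | generically [set x : X | P (x, y)]].
Proof.
move=> [W [oW [[x0 y0] W0] WP]].
exists [set y | W (x0, y)]; split; [exact: open_slice_snd|by exists y0|].
move=> y Wy; exists [set x | W (x, y)]; split; [exact: open_slice_fst|by exists x0|].
by move=> x /WP.
Qed.
End Slices.

(** * The function field of [Gm * X] is [K_X(t)] *)

Section ProductFunctions.
Variables (k : closedFieldType) (X : variety k).
Local Notation GmX := (prod_irr (Gm k) X).
Local Notation KX := (ratfun X).
Implicit Types (a b : {poly KX}) (F G : ratfun GmX).

(* A weaker notion than genericity on [Gm * X], which still detects equality of
   rational functions and is visibly stable under translations of [Gm]. *)
Definition fibrewise (P : Gm k -> X -> Prop) : Prop :=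
  generically [set x | generically [set g | P g x]].

Lemma fibrewise_sub (P Q : Gm k -> X -> Prop) :
  (forall g x, P g x -> Q g x) -> fibrewise P -> fibrewise Q.
Proof.
move=> PQ; apply: generically_sub => x; apply: generically_sub => g; exact: PQ.
Qed.

Lemma fibrewiseI (P Q : Gm k -> X -> Prop) :
  fibrewise P -> fibrewise Q -> fibrewise (fun g x => P g x /\ Q g x).
Proof.
move=> gP gQ; apply: generically_sub (genericallyI gP gQ) => x [Px Qx].
exact: genericallyI.
Qed.

Lemma fibrewise_snd (P : set X) : generically P -> fibrewise (fun=> P).
Proof. by apply: generically_sub => x Px; apply: generically_all. Qed.

Lemma fibrewise_fst (P : set (Gm k)) : generically P -> fibrewise (fun g _ => P g).
Proof. by move=> gP; apply: generically_all => x. Qed.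

Lemma fibrewise_generically (P : set GmX) : generically P ->
  fibrewise (fun g x => P (g, x)).
Proof. exact: generically_slice_snd. Qed.

Lemma fibrewise_translate (c : Gm k) (P : Gm k -> X -> Prop) : fibrewise P ->
  fibrewise (fun g => P (Gm_mul c g)).
Proof. by apply: generically_sub => x /(generically_translate c). Qed.

Lemma fibrewise_ex (P : Gm k -> X -> Prop) : fibrewise P -> exists g x, P g x.
Proof. by case/generically_ex=> x /generically_ex[g Pgx]; exists g, x. Qed.

(** A nonzero [F] has an inverse, and [F * F^-1] has value 1 generically, hence at some point where
    [F] has value 0. *)
Lemma ratfun_eq0_fibrewise F : fibrewise (fun g x => ratval F (g, x) = 0) -> F = 0.
Proof.
move=> F0; apply/eqP; apply: contraT => nF.
have := genericallyI (ratvalM F F^-1) (ratval_cst GmX 1).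
rewrite mulfV // => /fibrewise_generically/(fibrewiseI F0)/fibrewise_ex.
move=> [g [x /= [-> [-> ]]]]; rewrite mul0r => /eqP.
by rewrite eq_sym oner_eq0.
Qed.

Lemma ratval_inj_fibrewise F G :
  fibrewise (fun g x => ratval F (g, x) = ratval G (g, x)) -> F = G.
Proof.
move=> FG; apply/eqP; rewrite -subr_eq0; apply/eqP/ratfun_eq0_fibrewise.
have := fibrewise_generically (ratvalD (F - G) G); rewrite subrK.
move/(fibrewiseI FG); apply: fibrewise_sub => g x /= [->] e.
by apply: (addIr (ratval G (g, x))); rewrite add0r.
Qed.

Lemma snd_dominant : dominant (snd_ratmap (Gm k) X).
Proof. by move=> V _ [x Vx]; exists (Gm_one k, x). Qed.

Local Notation S := (dom_pullback snd_dominant).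
Local Notation u := (Gm_coord X).
Local Notation E := (@poly_to_ratfun k X).

Lemma poly_to_ratfunE a : E a = (map_poly S a).[u].
Proof. by []. Qed.

Lemma poly_to_ratfunD a b : E (a + b) = E a + E b.
Proof. by rewrite !poly_to_ratfunE rmorphD hornerD. Qed.

Lemma poly_to_ratfunM a b : E (a * b) = E a * E b.
Proof. by rewrite !poly_to_ratfunE rmorphM hornerM. Qed.

Lemma poly_to_ratfunC c : E c%:P = S c.
Proof. by rewrite poly_to_ratfunE map_polyC hornerC. Qed.

Lemma poly_to_ratfun0 : E 0 = 0.
Proof. by rewrite poly_to_ratfunC rmorph0. Qed.

Lemma poly_to_ratfun1 : E 1 = 1.
Proof. by rewrite poly_to_ratfunC rmorph1. Qed.

Lemma ratval_Gm_coord : generically [set q : GmX | ratval u q = val q.1].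
Proof.
have := ratval_class (PFun (@openT GmX) (setT_neq0 GmX) (@Gm_coord_regular k X)).
by apply: generically_sub => q [].
Qed.

Lemma ratval_poly_to_ratfun a :
  generically [set q : GmX | ratval (E a) q = (poly_at a q.2).[val q.1]].
Proof.
have := genericallyI (ratval_horner (map_poly S a) u)
  (genericallyI (poly_at_pullback snd_dominant a) ratval_Gm_coord).
by apply: generically_sub => q /= [e [ea eu]]; rewrite poly_to_ratfunE e ea eu.
Qed.

Lemma ratval_poly a :
  fibrewise (fun g x => ratval (E a) (g, x) = (poly_at a x).[val g]).
Proof. exact: fibrewise_generically (ratval_poly_to_ratfun a). Qed.

(** Transcendence of the coordinate over [K_X]: for generic [x], the polynomial [poly_at a x]
    vanishes at generic points of [Gm]. *)
Lemma poly_to_ratfun_eq0 a : E a = 0 -> a = 0.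
Proof.
move=> Ea; apply: poly_at_eq0.
have := fibrewiseI (ratval_poly a) (fibrewise_generically (ratval_cst GmX 0)).
apply: generically_sub => x h; apply: (@poly_eq0_generically _ _ idfun).
by apply: generically_sub h => g /= [<-]; rewrite Ea.
Qed.

(** Membership in the subfield [K_X(u)] of the function field of [Gm * X]. *)
Definition poly_quotient F : Prop := exists a b, b != 0 /\ F = E a / E b.

Lemma poly_to_ratfun_neq0 a : a != 0 -> E a != 0.
Proof. by apply: contraNneq => /poly_to_ratfun_eq0->. Qed.

Lemma poly_quotientE a : poly_quotient (E a).
Proof.
exists a, 1; rewrite poly_to_ratfun1 divr1.
by split; first exact: oner_neq0.
Qed.

Lemma poly_quotientD F G : poly_quotient F -> poly_quotient G -> poly_quotient (F + G).
Proof.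
move=> [a [b [b0 ->]]] [c [d [d0 ->]]]; exists (a * d + c * b), (b * d).
rewrite mulf_neq0 // addf_div ?poly_to_ratfun_neq0 //.
by rewrite poly_to_ratfunD !poly_to_ratfunM.
Qed.

Lemma poly_quotientM F G : poly_quotient F -> poly_quotient G -> poly_quotient (F * G).
Proof.
move=> [a [b [b0 ->]]] [c [d [d0 ->]]]; exists (a * c), (b * d).
by rewrite mulf_neq0 // mulf_div !poly_to_ratfunM.
Qed.

Lemma poly_quotientV F : poly_quotient F -> poly_quotient F^-1.
Proof.
move=> [a [b [b0 ->]]]; rewrite invf_div.
have [->|a0] := eqVneq a 0; last by exists b, a.
exists 0, 1; rewrite poly_to_ratfun0 invr0 mulr0 mul0r.
by split; first exact: oner_neq0.
Qed.

Lemma poly_at_cst (p : {poly k}) :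
  generically [set x | poly_at (map_poly (ratcst X) p) x = p].
Proof.
apply: generically_sub (generically_forall (size p) (fun i => ratval_cst X p`_i)).
move=> x h; rewrite /= -[in RHS](coefK p) /poly_at size_map_poly.
by apply: eq_poly => i lt_i; rewrite coef_map h.
Qed.

Lemma ratval_div F G : G != 0 ->
  generically [set q | ratval G q != 0 /\ ratval (F / G) q = ratval F q / ratval G q].
Proof.
move=> G0.
have := genericallyI (ratvalM F G^-1) (genericallyI (ratvalM G G^-1)
  (ratval_cst GmX 1)).
rewrite mulfV //; apply: generically_sub => q /= [-> [-> GV]].
have Gq : ratval G q != 0.
  by apply/eqP => e; move/eqP: GV; rewrite e mul0r eq_sym oner_eq0.
by split=> //; rewrite -[(ratval G q)^-1]mulr1 -GV mulKf.
Qed.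

Lemma tensor_poly_quotient (U : set (Gm k)) (V : set X) h :
  open U -> U !=set0 -> open V -> V !=set0 -> tensor_fun U V h ->
  exists2 F, poly_quotient F & fibrewise (fun g x => ratval F (g, x) = h (g, x)).
Proof.
move=> oU [g0 Ug0] oV V0.
have gU : fibrewise (fun g _ => U g).
  by apply: fibrewise_fst; exists U; split=> //; exists g0.
elim=> [f fr|f fr|f g _ [F qF eF] _ [G qG eG]|f g _ [F qF eF] _ [G qG eG]].
(* In [Gm_basis] the domain [D] is everything, so the fraction [p / q] found at [g0] is valid on all
   of [U] outside the roots of [q]. *)
- have [D [_ [_ [[-> [p ->]] [_ [q ->]] _ qg0 fpq]]]] := fr g0 Ug0.
  have q0 : q != 0 by apply: contraNneq qg0 => ->; rewrite horner0.
  pose pX := map_poly (ratcst X) p; pose qX := map_poly (ratcst X) q.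
  have qX0 : qX != 0 by rewrite map_poly_eq0.
  exists (E pX / E qX); first by exists pX, qX.
  have gq := fibrewise_fst (generically_nonroot q0).
  have gpq := fibrewise_snd (genericallyI (poly_at_cst p) (poly_at_cst q)).
  have gE := fibrewiseI (ratval_poly pX) (ratval_poly qX).
  have := fibrewise_generically (ratval_div (E pX) (poly_to_ratfun_neq0 qX0)).
  move/(fibrewiseI (fibrewiseI (fibrewiseI gq gU) (fibrewiseI gpq gE))).
  apply: fibrewise_sub => g x /= [[[gq0 Ug] [[epX eqX] [eEp eEq]]] [_ ->]].
  by rewrite eEp eEq epX eqX fpq.
- pose pf := PFun oV V0 fr.
  exists (E (ratclass pf)%:P); first exact: poly_quotientE.
  rewrite poly_to_ratfunC.
  have := fibrewise_generically (ratval_pullback snd_dominant (ratclass pf)).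
  move/(fibrewiseI (fibrewise_snd (ratval_class pf))).
  by apply: fibrewise_sub => g x /= [[_ e] ->].
- exists (F + G); first exact: poly_quotientD.
  have := fibrewiseI (fibrewiseI eF eG) (fibrewise_generically (ratvalD F G)).
  by apply: fibrewise_sub => t x /= [[-> ->] ->].
- exists (F * G); first exact: poly_quotientM.
  have := fibrewiseI (fibrewiseI eF eG) (fibrewise_generically (ratvalM F G)).
  by apply: fibrewise_sub => t x /= [[-> ->] ->].
Qed.

(** Near a point of its domain, [F] is a quotient of two tensor functions, and
    [tensor_poly_quotient] places both in [K_X(u)]. *)
Lemma ratfun_poly_quotient F : poly_quotient F.
Proof.
have [p ->] := ratclass_surj F; have [[g0 x0] pq] := pdom_neq0 p.
have [D [f [h [[U [V [oU oV eDU tf]]] [U' [V' [oU' oV' eD th]]] Dq hq fh]]]] :=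
  (pval_regular p : zariski_regular _ _ _) _ pq.
have [Ug Vx] : U g0 /\ V x0 by have : (U `*` V) (g0, x0) by rewrite -eDU.
have [Ug' Vx'] : U' g0 /\ V' x0 by have : (U' `*` V') (g0, x0) by rewrite -eD.
have [Ff qf ef] := tensor_poly_quotient oU (ex_intro _ _ Ug) oV (ex_intro _ _ Vx) tf.
have [Fh qh eh] := tensor_poly_quotient oU' (ex_intro _ _ Ug') oV' (ex_intro _ _ Vx') th.
suff -> : ratclass p = Ff / Fh by apply: poly_quotientM => //; apply: poly_quotientV.
have gh : generically [set q : GmX | D q /\ h q != 0].
  exists [set q : GmX | D q /\ h q != 0]; split=> //.
    move=> q [Dq' hq']; exists D, h; split=> //; by exists U', V'.
  by exists (g0, x0).
have gp := genericallyI gh (genericallyI (generically_dom p) (ratval_class p)).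
(* Otherwise [h] would vanish fibrewise, whereas it is nonzero on a nonempty open set. *)
have Fh0 : Fh != 0.
  apply/eqP => e; rewrite e in eh.
  have := fibrewiseI eh (fibrewise_generically (genericallyI gh (ratval_cst GmX 0))).
  by move=> /fibrewise_ex[g [x /= [<- [[_ /eqP]]]]].
apply: ratval_inj_fibrewise.
have := fibrewise_generically (genericallyI gp (ratval_div Ff Fh0)).
move/(fibrewiseI (fibrewiseI ef eh)); apply: fibrewise_sub => g x /=.
by move=> [[-> ->] [[[Dq' hq'] [pq' [_ ->]]] [_ ->]]]; apply: fh.
Qed.

End ProductFunctions.

Lemma divring_closed_horner (R : unitRingType) (A : {pred R}) (p : {poly R}) x :
  GRing.divring_closed A -> (forall i, p`_i \in A) -> x \in A -> p.[x] \in A.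
Proof.
move=> cA; have sA := GRing.divring_closedBM cA.
have [A0 AD] := GRing.zmod_closedD (GRing.subring_closedB sA).
have [_ AM] := GRing.smulr_closedM (GRing.subring_closedM sA).
case: p => s /= s0 As Ax; rewrite /horner /=.
elim: s {s0} As => //= c s IHs As; apply: AD (As 0%N); apply: AM => //.
by apply: IHs => i; apply: (As i.+1).
Qed.

(** * The comorphism and the derivation of a rational action *)

Section Action.
Variables (k : closedFieldType) (X : variety k).
Local Notation GmX := (prod_irr (Gm k) X).
Local Notation KX := (ratfun X).
Variable phi : ratmap GmX X.

(** By the unit axiom, some representative [g] of [phi] sends a point [(1, x)] into [V]. The
    preimage of [V] under [g] is then a nonempty open set, and it meets the locus where [g] and
    [phi] agree. *)
Lemma action_dominant : rational_Gm_action phi -> dominant phi.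
Proof.
move=> [_ unit_phi] V oV V0.
have gV : generically V by exists V; split.
have [x [Vx [g [phig gx ex]]]] := generically_ex (genericallyI gV unit_phi).
have gW : generically (rdom g `&` rmap g @^-1` V).
  exists (rdom g `&` rmap g @^-1` V); split=> //.
    by have [] := rmap_morphism g oV (regular_cst 1 oV).
  by exists (Gm_one k, x); split=> //=; rewrite ex.
have [q [[_ /= Vq] [phiq _ e]]] := generically_ex (genericallyI gW phig).
by exists q; split=> //=; rewrite e.
Qed.

Hypothesis phi_action : rational_Gm_action phi.
Local Notation phi_dom := (action_dominant phi_action).
Local Notation P := (dom_pullback phi_dom).
Local Notation S := (dom_pullback (@snd_dominant k X)).
Local Notation u := (Gm_coord X).
Local Notation E := (@poly_to_ratfun k X).
Local Notation "x %:F" := (tofrac x).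

Lemma action_coaction f a b : P f * E b = E a ->
  map_poly P a * (map_poly S b \Po (u *: 'X)) =
  (map_poly S a \Po (u *: 'X)) * map_poly P b.
Proof.
move=> Pf; apply/eqP; rewrite -subr_eq0; apply/eqP.
(* Specialise t to constants c, then compare values at points (g, x), where
   f (phi (c, phi (g, x))) = f (phi (c g, x)). *)
apply: (@poly_eq0_generically _ _ (ratcst GmX)).
have gf : generically [set q : GmX | rdom phi q /\
    ratval f (rmap phi q) * (poly_at b q.2).[val q.1] = (poly_at a q.2).[val q.1]].
  have rdom_phi : generically (rdom phi).
    by exists (rdom phi); split=> //; [exact: rdom_open|exact: rdom_neq0].
  have := genericallyI (genericallyI rdom_phi (ratval_pullback phi_dom f))
    (genericallyI (ratvalM (P f) (E b))
      (genericallyI (ratval_poly_to_ratfun a) (ratval_poly_to_ratfun b))).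
  rewrite Pf; apply: generically_sub => q /= [[? e1] [e2 [e3 e4]]]; split=> //.
  by rewrite -e1 -e4 -e2 e3.
have := genericallyI (generically_slice_fst gf)
  (generically_slice_fst (proj1 phi_action)).
apply: generically_sub => c [gfc assoc_c] /=.
apply/eqP; rewrite hornerD hornerN subr_eq0; apply/eqP.
rewrite !hornerM !horner_comp !hornerE -/(ratcst GmX (val c)).
apply: ratval_inj_fibrewise.
have hP r := genericallyI (ratval_horner (map_poly P r) (ratcst GmX (val c)))
  (poly_at_pullback phi_dom r).
have hS r := genericallyI (ratval_horner (map_poly S r) (u * ratcst GmX (val c)))
  (poly_at_pullback (@snd_dominant k X) r).
have hc := genericallyI (ratval_cst GmX (val c))
  (genericallyI (ratvalM u (ratcst GmX (val c))) (ratval_Gm_coord X)).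
have hM := genericallyI
  (ratvalM (map_poly P a).[ratcst GmX (val c)]
     (map_poly S b).[u * ratcst GmX (val c)])
  (ratvalM (map_poly S a).[u * ratcst GmX (val c)]
     (map_poly P b).[ratcst GmX (val c)]).
have := genericallyI (genericallyI (genericallyI (hP a) (hP b))
  (genericallyI (hS a) (hS b))) (genericallyI (genericallyI hc hM)
  (genericallyI assoc_c (generically_preimage phi_dom gfc))).
move/fibrewise_generically.
move/(fibrewiseI (fibrewise_translate c (fibrewise_generically gf))).
apply: fibrewise_sub => g x /= [[phi_cg f_cg]].
move=> [[[[-> ->] [-> ->]] [[-> ->] [-> ->]]] [[[-> [-> ->]] [-> ->]]]].
move=> [[y y_at [z z_at z_at']] [phi_g [phi_c f_c]]].
(* [phi] is defined at the three points involved, so separatedness turns the associativity axiom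
   into an equality of values of [rmap phi]. *)
have {y_at} ey := ratmap_atE phi_g y_at; rewrite {y}ey in z_at.
have {}z_at := ratmap_atE phi_c z_at; have {z_at'}ez := ratmap_atE phi_cg z_at'.
rewrite -f_c -z_at ez [val g * _]mulrC -f_cg; ring.
Qed.

(** The fraction chosen by [comorphism] is unique because [E] is injective on polynomials. *)
Lemma comorphism_eq f a b : b != 0 -> P f * E b = E a ->
  comorphism phi f = a%:F / b%:F.
Proof.
move=> b0 Pf; have Eb0 := poly_to_ratfun_neq0 b0.
rewrite /comorphism; case: xgetP => [_ -> [c [d [[d0 ->] Pf']]]|]; last first.
  by move=> /(_ (a%:F / b%:F))[]; exists a, b; rewrite -Pf mulfK.
apply/tofrac_divP => //; apply/eqP; rewrite -subr_eq0; apply/eqP.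
apply: poly_to_ratfun_eq0.
rewrite -[- _]mulN1r -[-1]/(- 1%:P) -polyCN poly_to_ratfunD !poly_to_ratfunM.
rewrite -Pf poly_to_ratfunC rmorphN1 mulN1r.
have -> : P f = E c / E d by [].
by rewrite mulrAC mulfVK ?subrr // poly_to_ratfun_neq0.
Qed.

Lemma comorphism_frac f : exists a b,
  [/\ b != 0, P f * E b = E a & comorphism phi f = a%:F / b%:F].
Proof.
have [a [b [b0 Pf]]] := ratfun_poly_quotient (P f).
have {}Pf : P f * E b = E a by rewrite Pf mulfVK // poly_to_ratfun_neq0.
by exists a, b; split=> //; apply: comorphism_eq.
Qed.

Lemma comorphism_poly f a : comorphism phi f = a%:F <-> P f = E a.
Proof.
split=> [|Pf].
  have [c [d [d0 Pf ->]]] := comorphism_frac f.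
  rewrite -[a%:F]divr1 -tofrac1 => /tofrac_divP-/(_ d0 (oner_neq0 _)).
  rewrite mulr1 => e; have Ed0 := poly_to_ratfun_neq0 d0.
  by apply: (mulIf Ed0); rewrite Pf e poly_to_ratfunM.
rewrite (@comorphism_eq f a 1) ?oner_neq0 ?tofrac1 ?divr1 //.
by rewrite poly_to_ratfun1 mulr1.
Qed.

Lemma invariantsE f : invariants phi f <-> P f = S f.
Proof. by rewrite -poly_to_ratfunC; apply: comorphism_poly. Qed.

Lemma invariants_poly (p : {poly KX}) :
  (forall i, invariants phi p`_i) <-> map_poly P p = map_poly S p.
Proof.
split=> [Fp|e i].
  by apply/polyP => i; rewrite !coef_map /=; apply/invariantsE.
by apply/invariantsE; move/(congr1 (fun q : {poly ratfun GmX} => q`_i)): e;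
  rewrite !coef_map.
Qed.

Lemma rational_sliceE s : rational_slice phi s <-> P s = u * S s.
Proof.
have Eu : E ('X * s%:P) = u * S s.
  by rewrite poly_to_ratfunM poly_to_ratfunC poly_to_ratfunE map_polyX hornerX.
by rewrite /rational_slice -tofracM -Eu; apply: comorphism_poly.
Qed.

(** The condition on [b] puts the derivative, of denominator [b ^+ 2], in the local ring at 1, where
    [frac_ev] is meaningful. *)
Lemma action_derivationE f a b : b.[1] != 0 -> P f * E b = E a ->
  action_derivation phi f = quotient_deriv_at 1 a b.
Proof.
move=> b1 Pf; have b0 : b != 0 by apply: contraNneq b1 => ->; rewrite horner0.
rewrite /action_derivation (comorphism_eq b0 Pf) frac_derivE // frac_evE.
  by rewrite horner_exp hornerD hornerN !hornerM.
by rewrite horner_exp expf_neq0.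
Qed.

Lemma invariants_derivation f : invariants phi f -> action_derivation phi f = 0.
Proof.
move=> /invariantsE; rewrite -poly_to_ratfunC => Pf.
rewrite (@action_derivationE f f%:P 1) ?hornerC ?oner_neq0 //.
  by rewrite -[f%:P]mul1r quotient_deriv_atZ derivC horner0 mul0r.
by rewrite poly_to_ratfun1 mulr1.
Qed.

(** * Consequences of the existence of a nonzero slice *)

Section SliceAction.
Variable s : KX.
Hypotheses (s_neq0 : s != 0) (s_slice : rational_slice phi s).

Let Ps : P s = u * S s. Proof. exact/rational_sliceE. Qed.

Lemma slice_transcendental_over : transcendental_over (invariants phi) s.
Proof.
move=> p /invariants_poly.
exact: (@slice_transcendental _ _ P S u (@poly_to_ratfun_eq0 k X)).
Qed.

Lemma slice_fraction f : exists a b : {poly KX},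
  [/\ forall i, invariants phi a`_i, forall i, invariants phi b`_i,
      b.[s] != 0 & f = a.[s] / b.[s]].
Proof.
have [a [b [ea eb bs ef]]] := @slice_generates _ _ P S u (@poly_to_ratfun_eq0 k X)
  (@ratfun_poly_quotient k X) action_coaction s s_neq0 Ps f.
by exists a, b; split=> //; apply/invariants_poly.
Qed.

(** Source of [ord_1 (phi^* f) >= 0] and [ev_1 (phi^* f) = f]: the fraction is [a (s t) / b (s t)]
    with invariant coefficients, and at 1 its denominator is the nonzero [b.[s]]. *)
Lemma comorphism_local f : exists a b : {poly KX},
  [/\ b.[1] != 0, P f * E b = E a & f = a.[1] / b.[1]].
Proof.
have [a [b [/invariants_poly ea /invariants_poly eb bs ef]]] := slice_fraction f.
have e1 (p : {poly KX}) : (p \Po (s *: 'X)).[1] = p.[s].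
  by rewrite horner_comp !hornerE.
have eE (p : {poly KX}) : map_poly P p = map_poly S p -> E (p \Po (s *: 'X)) = P p.[s].
  move=> e; rewrite poly_to_ratfunE map_comp_poly map_polyZ map_polyX.
  by rewrite horner_comp !hornerE [S s * _]mulrC -Ps -e horner_map.
exists (a \Po (s *: 'X)), (b \Po (s *: 'X)); rewrite !e1; split=> //.
by rewrite !eE // -rmorphM {1}ef mulfVK.
Qed.

(** The set [A] is left free to cover both the field of invariants and the kernel of the derivation,
    which contains it. *)
Lemma slice_gen_subfield (A : set KX) : invariants phi `<=` A ->
  gen_subfield (A `|` [set s]) = setT.
Proof.
move=> FA; apply/seteqP; split=> // f _ T cT AT.
have [a [b [Fa Fb _ ->]]] := slice_fraction f.
have sT : s \in T by apply: AT; right.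
have FT (p : {poly KX}) : (forall i, invariants phi p`_i) -> p.[s] \in T.
  by move=> Fp; apply: divring_closed_horner => // i; apply: AT; left; apply: FA.
by have [_ _ div] := cT; apply: div; apply: FT.
Qed.

(** Additivity and the Leibniz rule are those of [quotient_deriv_at] at 1, applied to the fractions
    of [comorphism_local], whose values at 1 are [f] and [g]. For [s], the comorphism is [s t], of
    derivative [s]. *)
Lemma action_derivation_s_dds : is_s_dds (invariants phi) s (action_derivation phi).
Proof.
split; last first.
  have Es : E ('X * s%:P) = P s.
    by rewrite Ps poly_to_ratfunM poly_to_ratfunC poly_to_ratfunE map_polyX hornerX.
  rewrite (@action_derivationE s ('X * s%:P) 1) ?hornerC ?oner_neq0 //.
    by rewrite quotient_deriv_atZ derivX hornerC mul1r.
  by rewrite poly_to_ratfun1 mulr1.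
split=> [f g|f g|f]; last exact: invariants_derivation.
- have [a [b [b1 Pf _]]] := comorphism_local f.
  have [c [d [d1 Pg _]]] := comorphism_local g.
  rewrite (action_derivationE b1 Pf) (action_derivationE d1 Pg).
  rewrite (@action_derivationE (f + g) (a * d + c * b) (b * d)).
  + exact: quotient_deriv_atD.
  + by rewrite hornerM mulf_neq0.
  + rewrite rmorphD poly_to_ratfunD !poly_to_ratfunM -Pf -Pg mulrDl /=.
    by rewrite mulrA [E b * _]mulrC mulrA.
- have [a [b [b1 Pf ef]]] := comorphism_local f.
  have [c [d [d1 Pg eg]]] := comorphism_local g.
  rewrite (action_derivationE b1 Pf) (action_derivationE d1 Pg).
  rewrite (@action_derivationE (f * g) (a * c) (b * d)).
  + by rewrite quotient_deriv_atM // -ef -eg.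
  + by rewrite hornerM mulf_neq0.
  + by rewrite rmorphM !poly_to_ratfunM -Pf -Pg mulrACA.
Qed.
End SliceAction.
End Action.

Theorem proposition3p4 (k : closedFieldType) (char0 : [pchar k] =i pred0)
    (X : variety k) (phi : ratmap (prod_irr (Gm k) X) X)
    (phi_action : rational_Gm_action phi)
    (phi_faithful : faithful_Gm_action phi)
    (s : ratfun X) (s_neq0 : s != 0) (s_slice : rational_slice phi s) :
  [/\ transcendental_over (invariants phi) s,
      gen_subfield (invariants phi `|` [set s]) = setT,
      gen_subfield (derivation_kernel phi `|` [set s]) = setT &
      is_s_dds (invariants phi) s (action_derivation phi)].
Proof.
split.
- exact: slice_transcendental_over.
- exact: (slice_gen_subfield phi_action s_neq0 s_slice (@subset_refl _ _)).
- apply: (slice_gen_subfield phi_action s_neq0 s_slice) => f Ff.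
  exact: (invariants_derivation phi_action).
- exact: action_derivation_s_dds.
Qed.
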